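(* Let $k$ be a field and let $F\subset k[x_1,\ldots,x_n]$ be a cohesive set of $n$ distinct monomials of degree two having no non-trivial common factor and such that every variable $x_i$ divides at least one member of $F$. Let $\widetilde{\mathcal{G}}$ be the graph, possibly with loops, on the vertex set $\{x_1,\ldots,x_n\}$ whose edges and loops correspond bijectively to the pairs $\{x_i,x_j\}$ with $x_ix_j\in F$ (possibly $i=j$), and let $\mathcal{G}\subset\widetilde{\mathcal{G}}$ be the underlying simple graph obtained by omitting all loops. Let $A$ denote the $n\times n$ incidence matrix of $\widetilde{\mathcal{G}}$. The following conditions are equivalent: (i) $\det A\neq 0$. (ii) $F$ defines a Cremona transformation of $\mathbb{P}^{n-1}$. (iii) Either (a) $\widetilde{\mathcal{G}}=\mathcal{G}$ (i.e. there are no loops), $\mathcal{G}$ has a unique cycle and this cycle has odd length; or else (b) $\widetilde{\mathcal{G}}$ is a tree with exactly one loop (i.e. $\mathcal{G}$ is a tree and $\widetilde{\mathcal{G}}$ has exactly one loop). (iv) The ideal $(F)\subset k[x_1,\ldots,x_n]$ is of linear type.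
   Context: The incidence matrix $A$ of $\widetilde{\mathcal{G}}$ is the integer log-matrix of $F$: its columns are the exponent vectors of the monomials in $F$, so a loop at $x_i$ gives the column $2e_i$ and an edge $x_ix_j$ the column $e_i+e_j$. A set $F$ of forms of fixed degree $\geq 2$ is cohesive if the forms have no non-trivial common factor and there is no partition $\mathbf{x}=\mathbf{y}\cup\mathbf{z}$ of the set of variables together with a decomposition $F=G\cup H$, with $G$ and $H$ both nonempty, such that the forms in $G$ involve only the $\mathbf{y}$-variables and the forms in $H$ involve only the $\mathbf{z}$-variables. A Cremona transformation is a birational map of $\mathbb{P}^{n-1}$ onto itself; $F$ defines one if the rational map $\mathbb{P}^{n-1}\dashrightarrow\mathbb{P}^{n-1}$ with coordinates the elements of $F$ is birational, equivalently if $k[F]$ and $k[\mathbf{x}_2]$ ($\mathbf{x}_2$ being the set of all monomials of degree 2) have the same field of fractions. An ideal $I$ is of linear type if the natural map from its symmetric algebra to its Rees algebra is an isomorphism. *)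

(* Defs.v *)
From HB Require Import structures.
From mathcomp Require Import all_boot all_order all_algebra.
From mathcomp Require Import ring_quotient.
From mathcomp Require Import boolp.
From mathcomp Require Import finmap.
From mathcomp Require monalg.
From mathcomp Require Import mpoly.

Set Implicit Arguments.
Unset Strict Implicit.
Unset Printing Implicit Defensive.

Import GRing.Theory.
Local Open Scope ring_scope.

Section GeneratedIdeal.
Variable (R : comNzRingType).
Implicit Types (G : R -> Prop) (f : R).

Definition in_ideal G f : Prop :=
  exists s : seq (R * R),
    (forall ag, ag \in s -> G ag.2) /\ f = \sum_(ag <- s) ag.1 * ag.2.

Definition ideal G : {pred R} := fun f => `[< in_ideal G f >].

Lemma idealP G f : reflect (in_ideal G f) (f \in ideal G).
Proof. exact: asboolP. Qed.

Lemma ideal_sub G f : G f -> f \in ideal G.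
Proof.
move=> Gf; apply/idealP; exists [:: (1, f)]; split.
  by move=> ag; rewrite inE => /eqP->.
by rewrite big_seq1 mul1r.
Qed.

Lemma ideal_linear_closed G : 0 \in ideal G /\
  (forall a, {in ideal G &, forall u v, a * u + v \in ideal G}).
Proof.
split=> [|a u v /idealP[s [sG ->]] /idealP[t [tG ->]]].
  by apply/idealP; exists [::]; rewrite big_nil.
apply/idealP; exists ([seq (a * x.1, x.2) | x <- s] ++ t); split.
  by move=> x; rewrite mem_cat => /orP[/mapP[y ys ->]|/tG //]; exact: sG ys.
rewrite big_cat big_map mulr_sumr; congr (_ + _).
by apply: eq_bigr => x _; rewrite mulrA.
Qed.

Lemma ideal_min G (P : R -> Prop) : P 0 ->
  (forall a u v, G u -> P v -> P (a * u + v)) ->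
  forall f, f \in ideal G -> P f.
Proof.
move=> P0 PS f /idealP[s [sG ->]]; elim: s sG => [|x s IHs] sG.
  by rewrite big_nil.
rewrite big_cons; apply: PS; first by apply: sG; rewrite inE eqxx.
by apply: IHs => y ys; apply: sG; rewrite inE ys orbT.
Qed.

End GeneratedIdeal.

(* The symmetric algebra of an R-module M, as the polynomial ring over R in one
   variable [gen x] for each element x of M, modulo the ideal generated by the
   R-linearity relations between these variables. [lift_inj] and [lift_unique]
   are its universal property. The constants are locked because unification
   diverges when it unfolds them. *)
Module SymAlg.
Import monalg.

HB.lock Definition gen (R : comNzRingType) (M : lmodType R) (x : M) :
  {malg R[{cmonom M}]} := << ucm x >>.

Section Sym.
Variables (R : comNzRingType) (M : lmodType R).

Local Notation poly_alg := {malg R[{cmonom M}]}.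

Inductive relator : poly_alg -> Prop :=
| rel_add (x y : M) : relator (gen (x + y) - gen x - gen y)
| rel_scale (a : R) (x : M) : relator (gen (a *: x) - a *: gen x).

Section EvalDef.
Variables (A : comAlgType R) (phi : M -> A).

Definition eval_monom (m : {cmonom M}) : A :=
  \prod_(x <- finsupp m) phi x ^+ m x.

Lemma eval_monomEw (d : {fset M}) (m : {cmonom M}) : (finsupp m `<=` d)%fset ->
  eval_monom m = \prod_(x <- d) phi x ^+ m x.
Proof.
move=> le_md; rewrite /eval_monom (big_fset_incl _ le_md) // => x _.
by rewrite -cmE_eq0 => /eqP->; rewrite expr0.
Qed.

Lemma eval_monom_mmorphism : mmorphism eval_monom.
Proof.
split=> [m1 m2 /=|]; last by rewrite /eval_monom big1 // => x _; rewrite cm1 expr0.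
rewrite [LHS](@eval_monomEw (finsupp m1 `|` finsupp m2)%fset) ?mdomD //.
rewrite (@eval_monomEw (finsupp m1 `|` finsupp m2)%fset m1) ?fsubsetUl //.
rewrite (@eval_monomEw (finsupp m1 `|` finsupp m2)%fset m2) ?fsubsetUr //.
by rewrite -big_split; apply: eq_bigr => x _; rewrite cmM exprD.
Qed.

#[export] HB.instance Definition _ :=
  isMultiplicative.Build {cmonom M} A eval_monom eval_monom_mmorphism.

End EvalDef.
End Sym.

HB.lock Definition eval (R : comNzRingType) (M : lmodType R) (A : comAlgType R)
    (phi : M -> A) : {malg R[{cmonom M}]} -> A :=
  mmap (in_alg A) (eval_monom phi).

Section Quotient.
Variables (R : comNzRingType) (M : lmodType R).

Local Notation poly_alg := {malg R[{cmonom M}]}.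
Local Notation relator := (@relator R M).

Section EvalTheory.
Variables (A : comAlgType R) (phi : M -> A).

Lemma eval_is_zmod_morphism : zmod_morphism (eval phi).
Proof. rewrite eval.unlock; exact: rmorphB. Qed.
#[export] HB.instance Definition _ :=
  GRing.isZmodMorphism.Build poly_alg A (eval phi) eval_is_zmod_morphism.

Lemma eval_is_monoid_morphism : monoid_morphism (eval phi).
Proof. by rewrite eval.unlock; split; [exact: rmorph1 | exact: rmorphM]. Qed.
#[export] HB.instance Definition _ :=
  GRing.isMonoidMorphism.Build poly_alg A (eval phi) eval_is_monoid_morphism.

Lemma eval_gen x : eval phi (gen x) = phi x.
Proof.
rewrite gen.unlock eval.unlock mmapU /= scale1r mul1r /eval_monom mdomU big_seq_fset1.
by rewrite cmUU expr1.
Qed.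

Lemma evalZ a p : eval phi (a *: p) = a *: eval phi p.
Proof. by rewrite eval.unlock mmapZ /= mulr_algl. Qed.

End EvalTheory.

Lemma eval_rel (A : comAlgType R) (phi : {linear M -> A}) p :
  p \in ideal relator -> eval phi p = 0.
Proof.
move: p; apply: ideal_min => [|a u v ru v0]; first exact: rmorph0.
have {ru} eu : eval phi u = 0; last by rewrite rmorphD rmorphM /= v0 eu mulr0 addr0.
case: ru => [x y|b x].
  by rewrite !rmorphB /= !eval_gen raddfD addrAC addrK subrr.
by rewrite rmorphB /= evalZ !eval_gen linearZ subrr.
Qed.

Lemma ideal_rel_closed : idealr_closed (ideal relator).
Proof.
have [I0 Ilin] := ideal_linear_closed relator.
split=> //; apply/negP => /(@eval_rel R^o \0).
by rewrite rmorph1 => /eqP; rewrite oner_eq0.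
Qed.

Definition rel_ideal : poly_alg -> bool := ideal relator.

#[export] HB.instance Definition _ := isIdealr.Build poly_alg rel_ideal ideal_rel_closed.

Definition rel_idealr := Idealr.clone _ rel_ideal _.

Definition sym : Type := {ideal_quot rel_idealr}.

#[export] HB.instance Definition _ := GRing.ComNzRing.on sym.

End Quotient.

HB.lock Definition proj (R : comNzRingType) (M : lmodType R)
    (p : {malg R[{cmonom M}]}) : sym M :=
  (\pi_({ideal_quot rel_idealr M}) p)%qT.

HB.lock Definition repr_sym (R : comNzRingType) (M : lmodType R)
    (s : sym M) : {malg R[{cmonom M}]} := repr s.

Section SymTheory.
Variables (R : comNzRingType) (M : lmodType R).

Local Notation poly_alg := {malg R[{cmonom M}]}.
Local Notation relator := (@relator R M).
Local Notation sym := (sym M).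
Local Notation proj := (@proj R M).

Lemma repr_symK : cancel (@repr_sym R M) proj.
Proof. by move=> s; rewrite proj.unlock repr_sym.unlock reprK. Qed.

Lemma proj_is_zmod_morphism : zmod_morphism proj.
Proof. rewrite proj.unlock; exact: rmorphB. Qed.
#[export] HB.instance Definition _ :=
  GRing.isZmodMorphism.Build poly_alg sym proj proj_is_zmod_morphism.

Lemma proj_is_monoid_morphism : monoid_morphism proj.
Proof. by rewrite proj.unlock; split; [exact: rmorph1 | exact: rmorphM]. Qed.
#[export] HB.instance Definition _ :=
  GRing.isMonoidMorphism.Build poly_alg sym proj proj_is_monoid_morphism.

Lemma proj_eq0 p : proj p = 0 <-> p \in ideal relator.
Proof.
have E := @Quotient.idealrBE _ (rel_idealr M) p 0.
have {E} -> : p \in ideal relator =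
  (p == 0 %[mod {ideal_quot rel_idealr M}])%qT by rewrite -E subr0.
have P q : proj q = (\pi_({ideal_quot rel_idealr M}) q)%qT by rewrite proj.unlock.
have P0 := rmorph0 proj; split=> [E|/eqP E].
  by apply/eqP; exact: etrans (esym (P p)) (etrans E (etrans (esym P0) (P 0))).
by exact: etrans (P p) (etrans E (etrans (esym (P 0)) P0)).
Qed.

Lemma projP (s : sym) : exists p, s = proj p.
Proof. by exists (repr_sym s); rewrite repr_symK. Qed.

Definition scale (a : R) (s : sym) : sym := proj a%:MP * s.

Lemma scaleA a b s : scale a (scale b s) = scale (a * b) s.
Proof. by rewrite /scale mpolyCM (rmorphM proj) mulrA. Qed.
Lemma scale1 : left_id 1 scale.
Proof. by move=> s; rewrite /scale mpolyC1E (rmorph1 proj) mul1r. Qed.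
Lemma scaleDr : right_distributive scale +%R.
Proof. by move=> a s t; rewrite /scale mulrDr. Qed.
Lemma scaleDl s : {morph scale^~ s : a b / a + b}.
Proof. by move=> a b; rewrite /scale monalgUD (rmorphD proj) mulrDl. Qed.
#[export] HB.instance Definition _ := GRing.Zmodule_isLmodule.Build R sym
  scaleA scale1 scaleDr scaleDl.
Lemma scaleAl (a : R) (s t : sym) : a *: (s * t) = a *: s * t.
Proof. exact: mulrA. Qed.
#[export] HB.instance Definition _ := GRing.Lmodule_isLalgebra.Build R sym scaleAl.
#[export] HB.instance Definition _ := GRing.Lalgebra_isComAlgebra.Build R sym.

Lemma projZ : scalable proj.
Proof. by move=> a p; rewrite -mul_malgC (rmorphM proj). Qed.
#[export] HB.instance Definition _ := GRing.isScalable.Build R poly_alg sym *:%R proj projZ.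

Definition inj (x : M) : sym := proj (gen x).

Lemma inj_is_zmod_morphism : zmod_morphism inj.
Proof.
have D x y : inj (x + y) = inj x + inj y.
  apply/eqP; rewrite -subr_eq0 opprD addrA -!(rmorphB proj).
  by apply/eqP/proj_eq0; apply: ideal_sub; exact: rel_add.
by move=> x y; apply: (addIr (inj y)); rewrite -D !subrK.
Qed.
#[export] HB.instance Definition _ :=
  GRing.isZmodMorphism.Build M sym inj inj_is_zmod_morphism.
Lemma inj_is_scalable : scalable inj.
Proof.
move=> a x; rewrite /inj -projZ; apply/eqP; rewrite -subr_eq0 -(rmorphB proj).
by apply/eqP/proj_eq0; apply: ideal_sub; exact: rel_scale.
Qed.
#[export] HB.instance Definition _ :=
  GRing.isScalable.Build R M sym *:%R inj inj_is_scalable.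

Section Lift.
Variables (A : comAlgType R) (phi : {linear M -> A}).

Definition lift (s : sym) : A := eval phi (repr_sym s).

Lemma lift_proj p : lift (proj p) = eval phi p.
Proof.
apply/eqP; rewrite -subr_eq0 -(rmorphB (eval phi)); apply/eqP/eval_rel.
by apply/proj_eq0; rewrite (rmorphB proj) /= repr_symK subrr.
Qed.

Lemma lift_inj x : lift (inj x) = phi x.
Proof. by rewrite lift_proj eval_gen. Qed.

Lemma lift_is_zmod_morphism : zmod_morphism lift.
Proof.
move=> s t; have [p ->] := projP s; have [q ->] := projP t.
by rewrite -(rmorphB proj) !lift_proj (rmorphB (eval phi)).
Qed.
#[export] HB.instance Definition _ :=
  GRing.isZmodMorphism.Build sym A lift lift_is_zmod_morphism.
Lemma lift_is_monoid_morphism : monoid_morphism lift.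
Proof.
split=> [|s t]; first by rewrite -(rmorph1 proj) lift_proj (rmorph1 (eval phi)).
have [p ->] := projP s; have [q ->] := projP t.
by rewrite -(rmorphM proj) !lift_proj (rmorphM (eval phi)).
Qed.
#[export] HB.instance Definition _ :=
  GRing.isMonoidMorphism.Build sym A lift lift_is_monoid_morphism.
Lemma lift_is_scalable : scalable lift.
Proof.
by move=> a s; have [p ->] := projP s; rewrite -projZ !lift_proj evalZ.
Qed.
#[export] HB.instance Definition _ :=
  GRing.isScalable.Build R sym A *:%R lift lift_is_scalable.

Lemma monomE (m : {cmonom M}) :
  << m >> = \prod_(x <- finsupp m) gen x ^+ m x :> poly_alg.
Proof.
pose e n x : {cmonom M} := iter n (mmul (ucm x)) mone.
have eE n x y : e n x y = ((x == y) * n)%N.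
  by elim: n => [|n IHn] /=; rewrite ?cm1 ?muln0 // cmM IHn cmU mulnS.
have em : m = \big[mmul/mone]_(x <- finsupp m) e (m x) x.
  apply/eqP/cmP => y; rewrite (big_morph (fun q : {cmonom M} => q y)
    (fun p q => cmM y p q) (cm1 y)).
  under eq_bigr do rewrite eE.
  case: (mdomP m y) => [ym|ny].
    rewrite (big_fsetD1 y) //= eqxx mul1n big1_fset ?addn0 // => x.
    by rewrite !inE => /andP[/negPf-> _].
  by rewrite big1_seq // => x /andP[_ xm]; case: eqP => // xy; rewrite -xy xm in ny.
rewrite {1}em.
have U1 : << (mone : {cmonom M}) >> = 1 :> poly_alg by [].
have UM : {morph (fun q : {cmonom M} => << q >> : poly_alg) :
    p q / mmul p q >-> p * q}.
  move=> p q; have := @fgmulUU {cmonom M} R 1 1 p q.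
  by rewrite mulr1 => <-; rewrite -malgM_def.
rewrite (big_morph (fun q : {cmonom M} => << q >> : poly_alg) UM U1).
apply: eq_bigr => x _; rewrite gen.unlock /e.
elim: (m x) => [|n IHn]; first by rewrite expr0.
by rewrite exprS -IHn; exact: UM.
Qed.

Lemma mkmalgUE (c : R) (m : {cmonom M}) : << c *g m >> = c *: << m >> :> poly_alg.
Proof.
apply/malgP => k; rewrite monalg.mcoeffZ.
have E1 := monalg.mcoeffU m (1 : R) k; apply: etrans (monalg.mcoeffU m c k) _.
by rewrite -[c in LHS]mulr1 -mulrnAr -E1.
Qed.

Lemma lift_unique (f : {lrmorphism sym -> A}) :
  (forall x, f (inj x) = phi x) -> f =1 lift.
Proof.
move=> fE s; have [p ->] := projP s; rewrite (monalgE p).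
rewrite (raddf_sum proj) (raddf_sum f) (raddf_sum lift); apply: eq_bigr => m _.
set c := monalg.mcoeff m p.
rewrite mkmalgUE monomE /= projZ [LHS]linearZ [RHS]linearZ; congr (_ *: _).
rewrite (rmorph_prod proj) (rmorph_prod f) (rmorph_prod lift) /=.
apply: eq_bigr => x _; rewrite (rmorphXn proj) (rmorphXn f) (rmorphXn lift) /=.
by congr (_ ^+ _); exact: etrans (fE x) (esym (lift_inj x)).
Qed.

End Lift.
End SymTheory.
Module Exports. HB.reexport. End Exports.
End SymAlg.
Export SymAlg.Exports.

(* Below, I is the ideal of R generated by G, and t is the variable of {poly R}. *)
Section LinearType.
Variables (R : comNzRingType) (G : R -> Prop).

Definition ideal_pred : pred R^o := ideal G.

Lemma ideal_submod_closed : GRing.submod_closed ideal_pred.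
Proof. exact: ideal_linear_closed. Qed.

Definition ideal_mod : Type := {f : R^o | ideal_pred f}.

HB.instance Definition _ := SubChoice.on ideal_mod.
HB.instance Definition _ :=
  GRing.SubChoice_isSubLmodule.Build R R^o ideal_pred ideal_mod ideal_submod_closed.

(* R[It], the R-subalgebra of R[t] generated by the a t with a in I. *)
Definition rees : pred {poly R} := fun p =>
  `[< forall S : {pred {poly R}}, GRing.subalg_closed S ->
        (forall a, a \in ideal G -> a *: 'X \in S) -> p \in S >].

Lemma rees_subalg_closed : GRing.subalg_closed rees.
Proof.
split=> [|a p q /asboolP Hp /asboolP Hq|p q /asboolP Hp /asboolP Hq];
    apply/asboolP => S Salg SX; have [S1 SL SM] := Salg.
- exact: S1.
- by apply: SL; [apply: Hp Salg SX | apply: Hq Salg SX].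
- by apply: SM; [apply: Hp Salg SX | apply: Hq Salg SX].
Qed.

Definition rees_alg : Type := {p : {poly R} | rees p}.

HB.instance Definition _ := SubChoice.on rees_alg.
HB.instance Definition _ :=
  GRing.SubChoice_isSubAlgebra.Build R {poly R} rees rees_alg rees_subalg_closed.
HB.instance Definition _ :=
  GRing.SubNzRing_isSubComNzRing.Build {poly R} rees rees_alg.

Lemma rees_gen (a : ideal_mod) : rees (val a *: 'X).
Proof. by apply/asboolP => S _; apply; exact: valP. Qed.

Definition rees_inj (a : ideal_mod) : rees_alg := Sub (val a *: 'X) (rees_gen a).

Lemma rees_inj_is_linear : linear rees_inj.
Proof.
move=> c a b; apply: val_inj.
have V : val (c *: a + b) = (c * val a + val b : R) by exact: (linearP val c a b).
have W (x y : rees_alg) : val (c *: x + y) = c *: val x + val y.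
  exact: (linearP val c x y).
rewrite W !SubK; apply: etrans (congr1 (fun r : R => r *: 'X) V) _.
by rewrite scalerDl scalerA.
Qed.
HB.instance Definition _ :=
  GRing.isLinear.Build R ideal_mod rees_alg *:%R rees_inj rees_inj_is_linear.

Definition sym_to_rees : SymAlg.sym ideal_mod -> rees_alg :=
  SymAlg.lift rees_inj.

HB.instance Definition _ := GRing.LRMorphism.copy sym_to_rees (SymAlg.lift rees_inj).

Lemma sym_to_rees_inj a : val (sym_to_rees (SymAlg.inj a)) = val a *: 'X.
Proof. by rewrite /sym_to_rees SymAlg.lift_inj. Qed.

(* [sym_to_rees] is the R-algebra morphism that sends the class of a in I to a t,
   so bijectivity makes it an isomorphism. *)
Definition linear_type : Prop := bijective sym_to_rees.

End LinearType.

Section Forms.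
Variables (k : fieldType) (n : nat).
Implicit Types (f g : {mpoly k[n]}) (F : seq {mpoly k[n]}).

Definition mpdvd g f : Prop := exists q, f = q * g.

Definition no_common_factor F : Prop :=
  forall g, (forall f, f \in F -> mpdvd g f) -> g \is a GRing.unit.

Definition involves_only (Y : {set 'I_n}) f : Prop :=
  forall m, m \in msupp f -> forall i, m i != 0%N -> i \in Y.

(* F is viewed as a set: [=i] ignores order and multiplicity. *)
Definition separated F : Prop :=
  exists (Y Z : {set 'I_n}) (G H : seq {mpoly k[n]}),
    [/\ Y :|: Z = [set: 'I_n] /\ [disjoint Y & Z],
        F =i G ++ H,
        G != [::] /\ H != [::],
        forall f, f \in G -> involves_only Y f
      & forall f, f \in H -> involves_only Z f].

Definition cohesive F : Prop :=
  [/\ exists2 d, (2 <= d)%N & forall f, f \in F -> f \is d.-homog,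
      no_common_factor F
    & ~ separated F].

End Forms.

(* A rational map P^(n-1) --> P^(n-1) is given by n forms of the same degree, not
   all zero. Two such tuples define the same map when they are proportional over
   k(x_1..x_n), i.e. when all the 2 x 2 minors vanish. The composite is defined
   when substitution does not give the zero tuple, hence the [ratmap] conditions
   in [cremona]. *)
Section Cremona.
Variables (k : fieldType) (n : nat).
Implicit Types F G : n.-tuple {mpoly k[n]}.

Definition ratmap F : Prop :=
  (exists d, forall f, f \in F -> f \is d.-homog) /\ exists2 f, f \in F & f != 0.

Definition same_ratmap F G : Prop :=
  forall i j, tnth F i * tnth G j = tnth F j * tnth G i.

Definition ratmap_comp G F : n.-tuple {mpoly k[n]} :=
  [tuple tnth G i \mPo F | i < n].

Definition ratmap_id : n.-tuple {mpoly k[n]} := [tuple 'X_i | i < n].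

Definition cremona F : Prop :=
  ratmap F /\
  exists G, [/\ ratmap G,
    ratmap (ratmap_comp G F) /\ same_ratmap (ratmap_comp G F) ratmap_id
  & ratmap (ratmap_comp F G) /\ same_ratmap (ratmap_comp F G) ratmap_id].

End Cremona.

(* Cycles are subgraphs: a closed vertex sequence is identified with its set of
   edges, which forgets the starting point and the direction. *)
Section Graphs.
Variables (T : finType) (e : rel T).

Definition simple_part : rel T := [rel x y | (x != y) && e x y].

Definition is_cycle (c : seq T) : Prop := (2 < size c)%N /\ ucycle e c.

Definition cycle_edges (c : seq T) : {set {set T}} :=
  [set [set x; next c x] | x in c].

Definition unique_cycle (c : seq T) : Prop :=
  is_cycle c /\ forall c', is_cycle c' -> cycle_edges c' = cycle_edges c.

Definition is_tree : Prop :=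
  [/\ (0 < #|T|)%N, forall x y, connect e x y & forall c, ~ is_cycle c].

End Graphs.

Section MonomialData.
Variables (n : nat) (m : n.-tuple 'X_{1..n}).

Definition log_matrix : 'M[int]_n := \matrix_(i, j) (tnth m j i)%:Z.

(* [graph i i] holds iff x_i carries a loop. *)
Definition graph : rel 'I_n := [rel i j | (U_(i) + U_(j))%MM \in m].

Definition monomials (k : fieldType) : n.-tuple {mpoly k[n]} :=
  [tuple 'X_[tnth m j] | j < n].

End MonomialData.

(* Main.v *)
From HB Require Import structures.
Require Import Defs.
From mathcomp Require Import all_boot all_order all_algebra.
From mathcomp Require Import perm boolp mpoly.
From mathcomp Require Import zify.

(* All four conditions are compared with det A <> 0, i.e. with the absence of a
   relation F^b = F^d.

   A Cremona map satisfies no such relation, since composing it with its inverse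
   gives the variables up to a common factor. Conversely, if det A <> 0 the
   connected graph has a closed walk of odd length, so alternating sums along walks
   express every e_i + e_j as an integral combination of columns of A; adding a
   large constant vector to the coefficients yields the exponents of a monomial
   inverse.

   A closed walk of odd length exists iff there is a loop or an odd cycle. For a
   connected graph the left kernel of A modulo 2 is spanned by the all-ones vector,
   so the right kernel has dimension at most 1; every loop and every cycle gives a
   nonzero vector of it, hence there is at most one loop or cycle altogether.

   For linear type, Sym(I) is spanned by the products x^a Y^b, Y_j being the class
   of the j-th generator, which map to x^(a + Ab) t^|b|. If det A <> 0, two of them
   with the same image are equal: an exchange x^a Y_i = x^c Y_j with
   a + a_i = c + a_j makes them share a factor Y_j. Conversely, Sym(I) maps to
   k[Y_1..Y_n] by setting x = 0, so a relation F^b = F^d is not a consequence of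
   the linear ones. *)

Set Implicit Arguments.
Unset Strict Implicit.
Unset Printing Implicit Defensive.

Import Order.TTheory GRing.Theory Num.Theory.
Local Open Scope ring_scope.

(** * Exponent vectors *)

Section Exponents.
Variable n : nat.
Implicit Types (m : n.-tuple 'X_{1..n}) (a b c d : 'X_{1..n}).

(* [mexp m b] is the exponent vector of the monomial F^b in the elements of F, i.e.
   the product of the log-matrix with [b]. *)
Definition mexp m b : 'X_{1..n} := (\sum_(j < n) tnth m j *+ b j)%MM.

Lemma mexpE m b i : mexp m b i = (\sum_j tnth m j i * b j)%N.
Proof. by rewrite mnm_sumE; apply: eq_bigr => j _; rewrite mulmnE. Qed.

Lemma mexpD m b c : mexp m (b + c) = (mexp m b + mexp m c)%MM.
Proof.
apply/mnmP=> i; rewrite mnmDE !mexpE -big_split.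
by apply: eq_bigr => j _; rewrite mnmDE mulnDr.
Qed.

Lemma mexp0 m : mexp m 0%MM = 0%MM.
Proof. by apply/mnmP=> i; rewrite mexpE big1 ?mnm0E // => j _; rewrite mnm0E muln0. Qed.

Lemma mexpMn m b (c : nat) : mexp m (b *+ c) = (mexp m b *+ c)%MM.
Proof.
apply/mnmP=> i; rewrite mulmnE !mexpE big_distrl /=; apply: eq_bigr => j _.
by rewrite mulmnE mulnA.
Qed.

Lemma mexp_sum m (I : Type) (r : seq I) (P : pred I) (b : I -> 'X_{1..n}) :
  mexp m (\sum_(i <- r | P i) b i)%MM = (\sum_(i <- r | P i) mexp m (b i))%MM.
Proof. exact: (big_morph _ (mexpD m) (mexp0 m)). Qed.

Lemma mexpU m j : mexp m U_(j) = tnth m j.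
Proof.
apply/mnmP=> i; rewrite mexpE (bigD1 j) //= mnm1E eqxx muln1 big1 ?addn0 //.
by move=> l /negPf lj; rewrite mnm1E eq_sym lj muln0.
Qed.

Lemma mexp_log m b :
  log_matrix m *m (\col_j (b j)%:Z) = \col_i (mexp m b i)%:Z.
Proof.
apply/matrixP=> i j; rewrite !mxE mexpE -[RHS]natz natr_sum; apply: eq_bigr => l _.
by rewrite !mxE -PoszM -natz.
Qed.

(** Two exponent vectors with the same image differ by an integer kernel vector; conversely, a
    kernel vector splits into its positive and negative parts [b] and [c], which have the same
    image. *)
Lemma mexp_injP m : reflect (injective (mexp m)) (\det (log_matrix m) != 0).
Proof.
apply: (iffP idP) => [dA b c /(congr1 (fun a => \col_i (a i)%:Z)) | injA].
  rewrite -!mexp_log => /eqP; rewrite -subr_eq0 -mulmxBr => /eqP Ebc.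
  have [v0|v0] := eqVneq (\col_j (b j)%:Z - \col_j (c j)%:Z) 0.
    apply/mnmP=> j; move/matrixP/(_ j 0): v0; rewrite !mxE => /eqP.
    by rewrite subr_eq0 eqz_nat => /eqP.
  have : \det (log_matrix m)^T == 0.
    apply/det0P; exists (\col_j (b j)%:Z - \col_j (c j)%:Z)^T.
      by apply: contra_neq v0 => /(congr1 trmx); rewrite trmxK trmx0.
    by rewrite -trmx_mul Ebc trmx0.
  by rewrite det_tr (negPf dA).
rewrite -det_tr; apply/negP => /det0P[v v0 vA].
pose b := [multinom absz (Num.max (v 0 j) 0)%R | j < n].
pose c := [multinom absz (Num.max (- v 0 j) 0)%R | j < n].
have E : \col_j (b j)%:Z - \col_j (c j)%:Z = v^T.
  apply/matrixP=> j l; rewrite !mxE !mnmE (ord1 l); lia.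
have bc : b = c.
  apply: injA; apply/mnmP=> i.
  have : log_matrix m *m v^T = 0 by rewrite -[log_matrix m]trmxK -trmx_mul vA trmx0.
  rewrite -E mulmxBr !mexp_log => /eqP; rewrite subr_eq0 => /eqP /matrixP /(_ i 0).
  by rewrite !mxE => -[].
by move: E; rewrite bc subrr => /(congr1 trmx); rewrite trmxK trmx0 => E0; rewrite -E0 eqxx in v0.
Qed.

Lemma mdeg_mexp m b D : (forall a, a \in m -> mdeg a = D) ->
  mdeg (mexp m b) = (D * mdeg b)%N.
Proof.
move=> mD; rewrite mdeg_sum (mdegE b) big_distrr; apply: eq_bigr => j _ /=.
by rewrite mdegMn mD ?mem_tnth.
Qed.

Lemma mexp_deg m b c D : (0 < D)%N -> (forall a, a \in m -> mdeg a = D) ->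
  mexp m b = mexp m c -> mdeg b = mdeg c.
Proof.
move=> D0 mD /(congr1 (@mdeg n)); rewrite !(mdeg_mexp _ mD) => /eqP.
by rewrite eqn_pmul2l // => /eqP.
Qed.

Lemma deg2P a : mdeg a = 2%N -> exists i j, a = (U_(i) + U_(j))%MM.
Proof.
move=> a2; have [i ai] : exists i, (0 < a i)%N.
  apply/existsP; rewrite -[[exists _, _]]negbK negb_exists; apply/negP => /forallP a0.
  by move: a2; rewrite mdegE big1 // => i _; move: (a0 i); lia.
have Ua : (U_(i) <= a)%MM by rewrite lep1mP -lt0n.
have : mdeg (a - U_(i)) == 1%N.
  by move: a2; rewrite -{1}(submK Ua) mdegD mdeg1 addn1 => -[->].
case/mdeg1P => j /eqP aj; exists i, j.
by rewrite -(submK Ua) aj addmC.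
Qed.

End Exponents.

(** * Odd closed walks *)

Section OddWalks.
Variables (T : finType) (e : rel T).

(** The bipartite double cover: the bit records the parity of a walk, so a closed walk of odd length
    at [x] is a path from [(x, false)] to [(x, true)]. *)
Definition double_cover : rel (T * bool) :=
  [rel u v | e u.1 v.1 && (u.2 != v.2)].

Lemma path_double_cover x b p : path e x p ->
  connect double_cover (x, b) (last x p, b (+) odd (size p)).
Proof.
elim: p x b => [|y p IHp] x b /=; first by rewrite addbF connect0.
case/andP=> exy /(IHp _ (~~ b)) yp.
rewrite addbN -addNb; apply: connect_trans yp.
by apply: connect1; rewrite /double_cover /= exy; case: b.
Qed.

Lemma double_cover_path u p : path double_cover u p ->
  path e u.1 (map fst p) /\ (last u p).2 = u.2 (+) odd (size p).
Proof.
elim: p u => [|v p IHp] u /=; first by rewrite addbF.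
case/andP=> /andP[-> uv] /IHp[-> ->]; split=> //.
by rewrite addbN -addNb; congr (_ (+) _); case: u.2 v.2 uv => [] [].
Qed.

Lemma odd_cycle_cover c : cycle e c -> odd (size c) ->
  exists x, connect double_cover (x, false) (x, true).
Proof.
case: c => //= x c cyc oc; exists x.
by have := path_double_cover false cyc; rewrite last_rcons size_rcons /= oc.
Qed.

Lemma cover_odd_cycle x :
  connect double_cover (x, false) (x, true) -> exists2 c, cycle e c & odd (size c).
Proof.
case/connectP=> p pp lp; have [pe] := double_cover_path pp.
rewrite -lp /=; case/lastP: p pp lp pe => // p [y b] _.
rewrite last_rcons map_rcons size_rcons => -[<- _] pe odd_p.
by exists (x :: map fst p); rewrite //= size_map.
Qed.

Lemma not_uniq_split (c : seq T) : ~~ uniq c ->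
  exists x p q r, c = p ++ x :: q ++ x :: r.
Proof.
elim: c => //= y c IHc; rewrite negb_and negbK.
have [/splitPr[q r] _|yc /= /IHc[x [p [q [r ->]]]]] := boolP (y \in c).
  by exists y, [::], q, r.
by exists x, (y :: p), q, r.
Qed.

(* A closed walk that repeats a vertex splits there into two shorter ones, one
   of which is odd. *)
Lemma odd_ucycle c : cycle e c -> odd (size c) ->
  exists2 c', ucycle e c' & odd (size c').
Proof.
have [s] := ubnP (size c); elim: s c => // s IHs c ltcs cyc oc.
have [uc|/not_uniq_split[x [p [q [r Ec]]]]] := boolP (uniq c).
  by exists c => //; apply/andP.
have Es : size c = (size (x :: q) + size (x :: r ++ p))%N.
  by rewrite Ec !size_cat /= !size_cat /=; lia.
(* Rotated to start at the first [x], the walk is a concatenation of two closed walks based at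
   [x]. *)
have : cycle e ((x :: q) ++ x :: r ++ p).
  by rewrite -(cat_cons x r) catA cycle_catC cat_cons -Ec.
rewrite /= rcons_cat cat_path /= => /and3P[pq lq pr].
have [oq|oq] := boolP (odd (size (x :: q))).
  by apply: (IHs (x :: q)) => //=; [move: Es ltcs => /=; lia | rewrite rcons_path pq].
apply: (IHs (x :: r ++ p)) => //; first by move: Es ltcs => /=; lia.
by move: oc; rewrite Es oddD (negPf oq).
Qed.

Lemma double_cover_flip u v : connect double_cover u v ->
  connect double_cover (u.1, ~~ u.2) (v.1, ~~ v.2).
Proof.
case/connectP=> p; elim: p u => [|w p IHp] u /=; first by move=> _ ->.
case/andP=> uw /IHp{}IHp /IHp; apply: connect_trans; apply: connect1.
by move: uw; rewrite /double_cover /= (inj_eq negb_inj).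
Qed.

Lemma double_cover_sym : ssrbool.symmetric e -> connect_sym double_cover.
Proof. by move=> se; apply: sym_connect_sym => u v /=; rewrite /double_cover /= se eq_sym. Qed.

End OddWalks.

(** * Integer column span of the incidence matrix *)

Section Incidence.
Variables (n : nat) (m : n.-tuple 'X_{1..n}).
Hypothesis deg2 : forall a, a \in m -> mdeg a = 2%N.
Hypothesis conn : forall x y, connect (graph m) x y.

Local Notation A := (log_matrix m).
Local Notation e x := (delta_mx x 0 : 'cV_n).

Lemma graph_sym : ssrbool.symmetric (graph m).
Proof. by move=> x y; rewrite /graph /= addmC. Qed.

Lemma graphP x y : reflect (exists j, tnth m j = (U_(x) + U_(y))%MM) (graph m x y).
Proof. by apply: (iffP (tnthP _ _)) => -[j]; exists j. Qed.

Lemma tnth_edge j : exists x y, tnth m j = (U_(x) + U_(y))%MM.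
Proof. exact/deg2P/deg2/mem_tnth. Qed.

Lemma mul_log_delta j x y :
  tnth m j = (U_(x) + U_(y))%MM -> A *m delta_mx j 0 = e x + e y.
Proof.
move=> mj; rewrite -colE; apply/matrixP=> i l; rewrite !mxE (ord1 l) mj mnmDE !mnm1E.
by rewrite !andbT !natz PoszD ![_ == i]eq_sym.
Qed.

(** Along a walk, the columns taken with alternating signs telescope. *)
Lemma double_cover_span u v : connect (double_cover (graph m)) u v ->
  exists w, A *m w = (-1) ^+ u.2 *: e u.1 - (-1) ^+ v.2 *: e v.1.
Proof.
case/connectP=> p; elim: p u => [|w p IHp] u /=.
  by move=> _ ->; exists 0; rewrite mulmx0 subrr.
case/andP=> /andP[/graphP[j /mul_log_delta mj] uw] /IHp{}IHp /IHp[s sE].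
exists ((-1) ^+ u.2 *: delta_mx j 0 + s); rewrite mulmxDr sE -scalemxAr mj.
have -> : w.2 = ~~ u.2 by case: u.2 w.2 uw => [] [].
by rewrite scalerDr signrN scaleNr addrA addrK.
Qed.

Lemma connect_double_cover x y :
  exists b, connect (double_cover (graph m)) (x, false) (y, b).
Proof.
by have /connectP[p /(path_double_cover false) pp ->] := conn x y; eexists; exact: pp.
Qed.

(* Otherwise the graph is bipartite, and the signs of its two colour classes are
   orthogonal to all columns. *)
Lemma det_double_cover x : \det A != 0 ->
  connect (double_cover (graph m)) (x, false) (x, true).
Proof.
set dc := connect _; move=> dA; apply: contraNT dA => nxx.
have dcC : connect_sym (double_cover (graph m)).
  exact/double_cover_sym/graph_sym.
have dcT u v w : dc u v -> dc v w -> dc u w by exact: connect_trans.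
(* Without an odd closed walk at [x], each vertex is reached from [x] in exactly one parity. *)
have dcN y : dc (x, false) (y, true) = ~~ dc (x, false) (y, false).
  apply/idP/idP => [xy|nxy].
    apply: contra nxx => /(@double_cover_flip _ _ _ _) /= xy'.
    by apply: dcT xy _; rewrite /dc dcC.
  by have [[] // xy] := connect_double_cover x y; rewrite /dc xy in nxy.
pose s : 'rV[int]_n := \row_i (-1) ^+ dc (x, false) (i, false).
apply/det0P; exists s.
  apply/eqP => /matrixP /(_ 0 x); rewrite !mxE => /eqP.
  by rewrite signr_eq0.
apply/matrixP=> i j; have [y [z mj]] := tnth_edge j.
transitivity ((s *m (A *m (delta_mx j 0 : 'cV_n))) i 0).
  by rewrite mulmxA -colE [RHS]mxE.
rewrite (mul_log_delta mj) mulmxDr -!colE !mxE.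
have yz b : dc (y, b) (z, ~~ b).
  apply: connect1; apply/andP; split; last by case: b.
  by apply/graphP; exists j.
have -> : dc (x, false) (z, false) = ~~ dc (x, false) (y, false); last by rewrite signrN subrr.
apply/idP/idP => [xz|].
  by rewrite -dcN; apply: dcT xz _; rewrite /dc dcC; exact: yz true.
by rewrite -dcN => xy; apply: dcT xy _; exact: yz true.
Qed.

(** An odd closed walk makes the double cover connected, so [(j, true)] is reached from
    [(i, false)]; the telescoping sum along this walk is [e i + e j]. *)
Lemma span_pairs x : connect (double_cover (graph m)) (x, false) (x, true) ->
  forall i j, exists w, A *m w = e i + e j.
Proof.
move=> xx; have dcC : connect_sym (double_cover (graph m)).
  exact/double_cover_sym/graph_sym.
have xi i b : connect (double_cover (graph m)) (x, false) (i, b).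
  have [c xi] := connect_double_cover x i.
  have [<- //|nbc] := eqVneq c b; apply: connect_trans xx _.
  by have := double_cover_flip xi; rewrite /=; case: c b nbc {xi} => [] [].
move=> i j; have : connect (double_cover (graph m)) (i, false) (j, true).
  by apply: connect_trans (xi j true); rewrite dcC.
by case/double_cover_span=> w wE; exists w; rewrite wE expr0 expr1 scale1r scaleN1r opprK.
Qed.

(** The solutions for [i = j] are the columns of an integer matrix [W] with [A *m W = 2%:M]. *)
Lemma double_cover_det x : connect (double_cover (graph m)) (x, false) (x, true) ->
  \det A != 0.
Proof.
move/span_pairs=> span; have /fin_all_exists[w wE] i := span i i.
pose W := \matrix_(i, j) w j i 0.
have AW : A *m W = 2%:M.
  apply/matrixP=> i j; have /matrixP/(_ i 0) := wE j.
  rewrite !mxE eqxx andbT -mulr2n -mulrnA mulnC mulrnA => <-.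
  by apply: eq_bigr => l _; rewrite !mxE.
apply/eqP => dA; have /eqP := congr1 determinant AW.
by rewrite det_mulmx dA mul0r det_scalar eq_sym expf_eq0 andbF.
Qed.

End Incidence.

(** * Cycles modulo 2 *)

(** Length at least three rules out going back and forth along one edge; hence distinct positions on
    a cycle give distinct edges. *)
Lemma next_next (T : finType) (c : seq T) x :
  uniq c -> (2 < size c)%N -> x \in c -> next c (next c x) != x.
Proof.
move=> uc c2 xc; have [i s Ec] := rot_to xc.
have ur : uniq (rot i c) by rewrite rot_uniq.
rewrite -!(next_rot i uc) Ec; rewrite -(size_rot i) Ec in c2; rewrite Ec in ur.
case: s c2 ur {Ec} => [|y [|z s]] //= _; rewrite !inE !negb_or -!andbA.
case/and5P=> xy xz _ _ _; rewrite eqxx [y == x]eq_sym (negPf xy) eqxx.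
by rewrite eq_sym.
Qed.

Section ModTwo.
Variables (n : nat) (m : n.-tuple 'X_{1..n}).
Hypothesis deg2 : forall a, a \in m -> mdeg a = 2%N.
Hypothesis conn : forall x y, connect (graph m) x y.

Definition log_matrix2 : 'M['F_2]_n := \matrix_(i, j) (tnth m j i)%:R.

Definition edge_set (j : 'I_n) : {set 'I_n} := [set i | tnth m j i != 0%N].

Definition indicator (J : {set 'I_n}) : 'cV['F_2]_n := \col_j (j \in J)%:R.

Lemma indicator_inj : injective indicator.
Proof.
move=> J K JK; apply/setP=> j; move/matrixP/(_ j 0): JK; rewrite !mxE.
by case: (j \in J) (j \in K) => [] [].
Qed.

Lemma addF2_eq0 (a b : 'F_2) : a + b = 0 -> a = b.
Proof. by move/eqP; rewrite addr_eq0 oppr_pchar2 ?pchar_Fp // => /eqP. Qed.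

(** An edge between [x] and [z] imposes [s x + s z = 0], i.e. equality modulo 2, which propagates
    along walks. *)
Lemma left_kernel2 (s : 'rV_n) : s *m log_matrix2 = 0 -> forall x y, s 0 x = s 0 y.
Proof.
move=> sA x y; have /connectP[p] := conn x y.
elim: p x => [|z p IHp] x /=; first by move=> _ ->.
case/andP=> /graphP[j mj] /IHp{}IHp /IHp <-; apply: addF2_eq0.
have /matrixP/(_ 0 j) := sA; rewrite !mxE => <-.
under [RHS]eq_bigr do rewrite !mxE mj mnmDE !mnm1E natrD mulrDr.
rewrite big_split /=; congr (_ + _).
  rewrite (bigD1 x) //= eqxx mulr1 big1 ?addr0 // => i /negPf.
  by rewrite eq_sym => ->; rewrite mulr0.
rewrite (bigD1 z) //= eqxx mulr1 big1 ?addr0 // => i /negPf.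
by rewrite eq_sym => ->; rewrite mulr0.
Qed.

(** A square matrix has left and right kernels of equal dimension, here at most 1, and a line over
    ['F_2] has a single nonzero vector. *)
Lemma right_kernel2 (v w : 'cV['F_2]_n) : log_matrix2 *m v = 0 -> log_matrix2 *m w = 0 ->
  v != 0 -> w != 0 -> v = w.
Proof.
move=> Av Aw v0 w0.
have rK : (\rank (kermx log_matrix2^T) <= 1)%N.
  rewrite mxrank_ker mxrank_tr -mxrank_ker.
  apply: leq_trans (rank_leq_row (const_mx 1 : 'rV['F_2]_n)).
  apply/mxrankS/row_subP=> i; apply/sub_rVP.
  have /left_kernel2 K : row i (kermx log_matrix2) *m log_matrix2 = 0.
    by rewrite -row_mul mulmx_ker row0.
  exists (row i (kermx log_matrix2) 0 i); apply/matrixP=> l j.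
  by rewrite (ord1 l) (K j i) [RHS]mxE [const_mx _ _ _]mxE mulr1.
have kerT (u : 'cV['F_2]_n) : log_matrix2 *m u = 0 -> (u^T <= kermx log_matrix2^T)%MS.
  by move=> Au; apply/sub_kermxP; rewrite -trmx_mul Au trmx0.
have rT (u : 'cV['F_2]_n) : u != 0 -> \rank u^T = 1%N.
  by move=> u0; rewrite rank_rV -trmx0 (inj_eq trmx_inj) u0.
have /sub_rVP[a va] : (v^T <= w^T)%MS.
  apply: submx_trans (kerT _ Av) _.
  by rewrite -(mxrank_leqif_sup (kerT _ Aw)) eqn_leq mxrankS ?kerT //= rT.
have : a != 0.
  by apply: contra_neq v0 => a0; apply: trmx_inj; rewrite va a0 scale0r trmx0.
move=> a0; apply: trmx_inj; rewrite va; have -> : a = 1.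
  by case: a a0 {va} => [[|[|]]] //= ? _; apply: val_inj.
by rewrite scale1r.
Qed.

Lemma loop_kernel2 x : graph m x x -> exists2 j,
  tnth m j = (U_(x) + U_(x))%MM & log_matrix2 *m indicator [set j] = 0.
Proof.
case/graphP=> j mj; exists j => //; apply/matrixP=> i l; rewrite !mxE big1 // => l' _.
rewrite !mxE inE; have [->|_] := eqVneq; last by rewrite mulr0.
by rewrite mj mnmDE natrD mulrDl addrr_pchar2 ?pchar_Fp.
Qed.

(** Every vertex of a cycle lies on exactly two of its edges, so their columns sum to 0 modulo 2.
    The last clause distinguishes this kernel vector from the one of a loop. *)
Lemma cycle_kernel2 c : is_cycle (simple_part (graph m)) c -> exists J : {set 'I_n},
  [/\ J != set0, log_matrix2 *m indicator J = 0, cycle_edges c = edge_set @: J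
    & forall j x, j \in J -> tnth m j <> (U_(x) + U_(x))%MM].
Proof.
case=> c2 /andP[cc uc].
have next_edge x : exists j, x \in c -> tnth m j = (U_(x) + U_(next c x))%MM.
  have [xc|] := boolP (x \in c); last by exists x.
  have /andP[_ /graphP[j mj]] := next_cycle cc xc; by exists j.
have neq_next x : x \in c -> x != next c x.
  by move=> xc; have /andP[] := next_cycle cc xc.
have [f fE] := fin_all_exists next_edge.
have edge_f x : x \in c -> edge_set (f x) = [set x; next c x].
  move=> xc; apply/setP=> i; rewrite !inE fE // mnmDE !mnm1E addn_eq0 !eqb0 negb_and !negbK.
  by rewrite ![_ == i]eq_sym.
have inj_f : {in c &, injective f}.
  move=> x y xc yc fxy; have := edge_f _ xc; rewrite fxy edge_f // => E.
  have := set21 x (next c x); rewrite -E => /set2P[//|xn].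
  have := set21 y (next c y); rewrite E => /set2P[//|yn].
  by have /eqP[] := next_next uc c2 xc; rewrite -yn.
exists (f @: c); split.
- case: c c2 {cc uc next_edge neq_next fE edge_f inj_f} => // x c _; apply/set0Pn.
  by exists (f x); rewrite imset_f // inE eqxx.
- apply/matrixP=> i l; rewrite !mxE.
  transitivity (\sum_(j in f @: c) (tnth m j i)%:R : 'F_2).
    rewrite [RHS]big_mkcond; apply: eq_bigr => j _; rewrite !mxE.
    by case: ifP; rewrite ?mulr1 ?mulr0.
  rewrite big_imset //=.
  under eq_bigr => x xc do rewrite fE // mnmDE !mnm1E natrD.
  (* Since [next c] permutes the vertices of the cycle, the two sums agree and cancel in
     characteristic 2. *)
  rewrite big_split /= [X in X + _](reindex_inj (can_inj (prev_next uc))) /=.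
  by under eq_bigl do rewrite mem_next; rewrite addrr_pchar2 ?pchar_Fp.
- by rewrite -imset_comp; apply: eq_in_imset => x xc /=; rewrite edge_f.
move=> _ x /imsetP[y yc ->] fx.
have := edge_f _ yc; rewrite /edge_set fx => /setP E; have := neq_next _ yc.
have := E y; have := E (next c y); rewrite !inE !eqxx orbT !mnmDE !mnm1E !addn_eq0 !andbb !eqb0.
by rewrite !negbK /= => /eqP <- /eqP <-; rewrite eqxx.
Qed.

End ModTwo.

(** * Connectedness, and the graph condition against the determinant *)

Section Conditions.
Variables (k : fieldType) (n : nat) (m : n.-tuple 'X_{1..n}).
Hypothesis deg2 : forall a, a \in m -> mdeg a = 2%N.

Local Notation F := (monomials m k).
Local Notation G := (simple_part (graph m)).

(** Setting ['X_i] to 0 and the other variables to 1 kills the multiples of ['X_i] but no monomial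
    free of it. *)
Lemma mpdvd_monomial (i : 'I_n) (a : 'X_{1..n}) :
  mpdvd ('X_i : {mpoly k[n]}) 'X_[a] -> a i != 0%N.
Proof.
case=> q /(congr1 (meval (fun j => (j != i)%:R))); rewrite mevalM mevalX mevalXU eqxx mulr0.
move=> /eqP E; apply: contraL E => /eqP ai; rewrite prodf_seq_neq0; apply/allP=> j _ /=.
by have [->|_] := eqVneq j i; rewrite ?ai ?expr0 ?expr1n oner_eq0.
Qed.

Lemma monomialsP f : reflect (exists2 a, a \in m & f = 'X_[a]) (f \in F).
Proof.
apply: (iffP (tnthP _ _)) => [[j ->]|[a /tnthP[j ->] ->]].
  by exists (tnth m j); rewrite ?mem_tnth // tnth_mktuple.
by exists j; rewrite tnth_mktuple.
Qed.

(** The component of [x] and its complement would separate F: no edge joins them, and both parts of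
    F are nonempty because [x] and [y] each divide a member. *)
Lemma not_separated_connect : ~ separated F ->
  (forall i, exists2 f, f \in F & mpdvd 'X_i f) -> forall x y, connect (graph m) x y.
Proof.
move=> nsep vars x y; apply: contraPT isT => nxy; case: nsep.
pose Y := [set z | connect (graph m) x z].
pose inY (a : 'X_{1..n}) := [exists i in Y, a i != 0%N].
have mY a l l' : a \in m -> a l != 0%N -> a l' != 0%N -> (l \in Y) = (l' \in Y).
  move=> am; have [i [j aij]] := deg2P (deg2 am).
  have ij : graph m i j by rewrite /graph /= -aij.
  have E : (i \in Y) = (j \in Y).
    rewrite !inE; apply/idP/idP => /connect_trans; apply; apply: connect1 => //.
    by rewrite graph_sym.
  rewrite aij !mnmDE !mnm1E !addn_eq0 !eqb0 !negb_and !negbK.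
  by case/orP=> /eqP <- /orP[] /eqP <-.
exists Y, (~: Y), ([seq 'X_[a] | a <- m & inY a]), ([seq 'X_[a] | a <- m & ~~ inY a]).
split.
- by rewrite setUCr -setI_eq0 setICr eqxx.
- move=> f; rewrite mem_cat; apply/monomialsP/orP => [[a am ->]|].
    have [aY|aY] := boolP (inY a); [left|right]; apply/mapP; exists a => //.
      by rewrite mem_filter aY.
    by rewrite mem_filter aY.
  by case=> /mapP[a]; rewrite mem_filter => /andP[_ am] ->; exists a.
- split; rewrite -size_eq0 size_map size_filter -lt0n -has_count.
    have [_ /monomialsP[a am ->] /mpdvd_monomial ax] := vars x.
    by apply/hasP; exists a => //; apply/existsP; exists x; rewrite inE connect0.
  have [_ /monomialsP[a am ->] /mpdvd_monomial ay] := vars y.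
  apply/hasP; exists a => //; apply/existsPn => i; apply/negP => /andP[iY ai].
  by move: iY; rewrite (mY _ _ _ am ai ay) inE (negPf nxy).
- move=> f /mapP[a]; rewrite mem_filter => /andP[/existsP[i /andP[iY ai]] am] -> b.
  by rewrite msuppX inE => /eqP -> l al; rewrite (mY _ _ _ am al ai).
move=> f /mapP[a]; rewrite mem_filter => /andP[/existsPn aN am] -> b.
rewrite msuppX inE => /eqP -> l al; rewrite inE; apply/negP => lY.
by have := aN l; rewrite lY al.
Qed.

(** For n = 0 the set F is empty, so 0 would be a common factor. *)
Lemma no_common_factor_gt0 : no_common_factor F -> (0 < n)%N.
Proof.
rewrite lt0n => nf; apply/eqP => n0; have : (0 : {mpoly k[n]}) \is a GRing.unit.
  by apply: nf => f /tnthP[i _]; have := ltn_ord i; rewrite [X in (_ < X)%N]n0.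
by rewrite unitr0.
Qed.

Section Connected.
Hypothesis conn : forall x y, connect (graph m) x y.
Hypothesis n_gt0 : (0 < n)%N.

Let x0 := Ordinal n_gt0.

(** Two loops, two cycles, or a loop and a cycle would give distinct nonzero kernel vectors modulo
    2. In the absence of loops, the determinant supplies an odd closed walk and thus an odd
    cycle. *)
Lemma det_graph : \det (log_matrix m) != 0 ->
  [/\ graph m =2 G & exists2 c, unique_cycle G c & odd (size c)]
    \/ is_tree G /\ #|[set i | graph m i i]| = 1%N.
Proof.
move=> dA; have ker2 := right_kernel2 conn.
have ind0 (J : {set 'I_n}) : (indicator J != 0) = (J != set0).
  have -> : (0 : 'cV['F_2]_n) = indicator set0.
    by apply/matrixP=> i j; rewrite !mxE inE.
  by rewrite (inj_eq (@indicator_inj n)).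
have n1 (j : 'I_n) : indicator [set j] != 0.
  by rewrite ind0; apply/set0Pn; exists j; rewrite inE.
have loop_uniq x y : graph m x x -> graph m y y -> x = y.
  case/loop_kernel2=> i mi Ai /loop_kernel2[j mj Aj].
  have /indicator_inj/set1_inj ij := ker2 _ _ Ai Aj (n1 i) (n1 j).
  move: mi; rewrite ij mj => /mnmP/(_ x); rewrite !mnmDE !mnm1E eqxx.
  by case: eqP.
have loop_cycle x c : graph m x x -> ~ is_cycle G c.
  move=> /loop_kernel2[i mi Ai] /cycle_kernel2[J [J0 AJ _ JN]].
  rewrite -ind0 in J0; have /indicator_inj iJ := ker2 _ _ Ai AJ (n1 i) J0.
  by apply: (JN i x) mi; rewrite -iJ inE.
have connG x y : connect G x y.
  have /connectP[p] := conn x y; elim: p x => [|z p IHp] x /=; first by move=> _ ->.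
  case/andP=> xz /IHp{}IHp /IHp; have [->//|nxz] := eqVneq x z.
  by apply: connect_trans; apply: connect1; apply/andP.
have [/existsP[x xx]|/existsPn nl] := boolP [exists x, graph m x x].
  right; split.
    by split=> // [|c]; [apply/card_gt0P; exists x0 | exact: loop_cycle xx].
  apply/eqP/cards1P; exists x; apply/setP=> y; rewrite !inE.
  by apply/idP/eqP => [yy|->//]; exact: loop_uniq.
left; have GE : graph m =2 G.
  move=> x y; rewrite /simple_part /=; have [<-|//] := eqVneq x y.
  exact/negbTE/nl.
split=> //; have [c0 cc0 oc0] := cover_odd_cycle (det_double_cover deg2 conn x0 dA).
have [c ucc oc] := odd_ucycle cc0 oc0.
(* An odd closed walk without repetition has length 1 or at least 3, and length 1 would be a
   loop. *)
have c3 : (2 < size c)%N.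
  case: (c) ucc oc => // x [|y [|//]] //.
  by rewrite /ucycle /= !andbT => xx; have := nl x; rewrite xx.
have cyc : is_cycle G c by split=> //; rewrite /ucycle -(eq_cycle GE).
exists c => //; split=> // c' /cycle_kernel2[J' [J'0 AJ' -> _]].
have [J [J0 AJ -> _]] := cycle_kernel2 cyc; rewrite -!ind0 in J0 J'0.
by have -> : J' = J by apply: (@indicator_inj n); exact: ker2.
Qed.

Lemma graph_det :
  [/\ graph m =2 G & exists2 c, unique_cycle G c & odd (size c)]
    \/ is_tree G /\ #|[set i | graph m i i]| = 1%N ->
  \det (log_matrix m) != 0.
Proof.
case=> [[_ [c [[_ /andP[cc _]] _] oc]]|[_ /eqP/cards1P[x /setP/(_ x)]]].
  have cm : cycle (graph m) c by apply: sub_cycle cc => x y /andP[].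
  by have [x xx] := odd_cycle_cover cm oc; exact: double_cover_det conn _ xx.
rewrite !inE eqxx => xx; apply: (double_cover_det conn (x := x)).
by apply: connect1; rewrite /double_cover /= xx.
Qed.

End Connected.
End Conditions.

(** * Monomial Cremona transformations *)

Section MonomialMaps.
Variables (k : fieldType) (n : nat).
Implicit Types m B : n.-tuple 'X_{1..n}.

Lemma tnth_monomials m j : tnth (monomials m k) j = 'X_[tnth m j].
Proof. exact: tnth_mktuple. Qed.

Lemma mpolyX_sum (I : Type) (r : seq I) (P : pred I) (b : I -> 'X_{1..n}) :
  'X_[\sum_(i <- r | P i) b i] = \prod_(i <- r | P i) 'X_[b i] :> {mpoly k[n]}.
Proof. exact: (big_morph (fun a => 'X_[a] : {mpoly k[n]}) (@mpolyXD n k) (mpolyX0 n k)). Qed.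

Lemma comp_monomials m b : 'X_[b] \mPo monomials m k = 'X_[mexp m b].
Proof.
rewrite comp_mpolyX mpolyX_sum; apply: eq_bigr => j _.
by rewrite tnth_monomials mpolyXn.
Qed.

Lemma ratmap_comp_monomials m B j :
  tnth (ratmap_comp (monomials m k) (monomials B k)) j = 'X_[mexp B (tnth m j)].
Proof. by rewrite tnth_mktuple tnth_monomials comp_monomials. Qed.

Lemma ratmap_monomials (t : n.-tuple {mpoly k[n]}) (c : 'I_n -> 'X_{1..n}) D :
  (0 < n)%N -> (forall j, tnth t j = 'X_[c j]) -> (forall j, mdeg (c j) = D) -> ratmap t.
Proof.
move=> n0 tE cD; split; first by exists D => f /tnthP[j ->];
  rewrite tE dhomogX; apply/eqP; exact: cD.
exists (tnth t (Ordinal n0)); first exact: mem_tnth.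
by rewrite tE -msupp_eq0 msuppX.
Qed.

Lemma same_ratmap_id (t : n.-tuple {mpoly k[n]}) (c : 'I_n -> 'X_{1..n}) :
  (forall j, tnth t j = 'X_[c j]) ->
  (forall i j, (c i + U_(j))%MM = (c j + U_(i))%MM) -> same_ratmap t (ratmap_id k n).
Proof. by move=> tE cU i j; rewrite !tnth_mktuple !tE -!mpolyXD cU. Qed.

Variable m : n.-tuple 'X_{1..n}.
Hypothesis deg2 : forall a, a \in m -> mdeg a = 2%N.
Hypothesis n_gt0 : (0 < n)%N.

(* The inverse is monomial with exponents [B i], where [mexp m (B i) = U_i + g]. *)
Lemma span_cremona : injective (mexp m) ->
  (forall i j, exists w, log_matrix m *m w = delta_mx i 0 + delta_mx j 0 :> 'cV_n) ->
  cremona (monomials m k).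
Proof.
move=> injm span; pose x0 := Ordinal n_gt0.
have /fin_all_exists[w wE] i := span i x0.
(* [N] bounds every [absz (w i j 0)], so adding it makes all coefficients nonnegative. *)
pose N := (\sum_i \sum_j absz (w i j 0%R))%N.
pose ones := [multinom N | _ < n].
pose B := [tuple [multinom absz (w i j 0 + N%:Z)%R | j < n] | i < n].
pose g := (U_(x0) + mexp m ones)%MM.
have BE i : mexp m (tnth B i) = (U_(i) + g)%MM.
  apply/mnmP=> l; apply/eqP; rewrite -eqz_nat; apply/eqP.
  transitivity ((log_matrix m *m (w i + \col_j (ones j)%:Z)) l 0).
    have -> : w i + \col_j (ones j)%:Z = \col_j (tnth B i j)%:Z.
      apply/matrixP=> j z; rewrite !mxE (ord1 z) tnth_mktuple !mnmE.
      have : (absz (w i j 0%R) <= N)%N.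
        rewrite /N (bigD1 i) //= (bigD1 j) //= -addnA; exact: leq_addr.
      move: (w i j 0) (N) => z1 N1. lia.
    by rewrite mexp_log !mxE.
  rewrite mulmxDr wE mexp_log !mxE !mnmDE !mnm1E !andbT ![l == _]eq_sym.
  by rewrite !natz !PoszD addrA.
have Bdeg i j : mdeg (tnth B i) = mdeg (tnth B j).
  apply/eqP; rewrite -(eqn_pmul2l (m := 2)) // -!(mdeg_mexp _ deg2) !BE.
  by rewrite !mdegD !mdeg1.
have mB b : mexp m (mexp B b) = (b + g *+ mdeg b)%MM.
  rewrite mexp_sum; under eq_bigr do rewrite mexpMn BE.
  apply/mnmP=> l; rewrite mnm_sumE mnmDE mulmnE mdegE big_distrr /=.
  rewrite (_ : b l = \sum_i (U_(i)%MM l * b i))%N; last first.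
    by rewrite (bigD1 l) //= mnm1E eqxx mul1n big1 ?addn0 // => i /negPf il; rewrite mnm1E il.
  by rewrite -big_split; apply: eq_bigr => i _; rewrite mulmnE mnmDE mulnDl.
split.
  by apply: (ratmap_monomials (D := 2%N) n_gt0 (tnth_monomials m)) => j; rewrite deg2 ?mem_tnth.
exists (monomials B k); split.
- by apply: (ratmap_monomials n_gt0 (tnth_monomials B)) => j; exact: Bdeg j x0.
- split; first apply: (ratmap_monomials n_gt0 (ratmap_comp_monomials B m)) => j.
    by rewrite BE mdegD mdeg1.
  apply: (same_ratmap_id (ratmap_comp_monomials B m)) => i j; rewrite !BE.
  by apply/mnmP=> l; rewrite !mnmDE; lia.
split; first apply: (ratmap_monomials n_gt0 (ratmap_comp_monomials m B)) => j.
  rewrite (@mdeg_mexp n B _ (mdeg (tnth B x0))).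
    by rewrite (deg2 (mem_tnth j m)).
  by move=> a /tnthP[i ->]; exact: Bdeg.
(* This composite is compared after applying the injective [mexp m], where [mB] computes both
   sides. *)
apply: (same_ratmap_id (ratmap_comp_monomials m B)) => i j; apply: injm.
rewrite !mexpD !mB !mexpU !deg2 ?mem_tnth //.
by apply/mnmP=> l; rewrite !mnmDE; lia.
Qed.

(* A relation [mexp m b = mexp m d] is a relation between the coordinates of the
   composite, which are proportional to the variables. *)
Lemma cremona_inj : cremona (monomials m k) -> injective (mexp m).
Proof.
case=> _ [H [_ _ [[_ [f /tnthP[i ->] c0]] prop]]] b d Ebd.
have dbd := mexp_deg _ deg2 Ebd.
set t := ratmap_comp _ _ in prop c0; set c := tnth t i in c0.
have tX j : tnth t j * 'X_i = c * 'X_j.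
  by have := prop i j; rewrite ![tnth (ratmap_id k n) _]tnth_mktuple => ->.
have tE (a : 'X_{1..n}) : ('X_[a] \mPo t) * 'X_i ^+ mdeg a = c ^+ mdeg a * 'X_[a].
  rewrite comp_mpolyX [X in _ = _ * X]mpolyXE_id mdegE !expr_sum -!big_split /=.
  by apply: eq_bigr => j _; rewrite -!exprMn tX.
(* The coordinates of [t] are the members of F evaluated at [H], so the value of ['X_[a]] at [t]
   depends only on [mexp m a]. *)
have tm (a : 'X_{1..n}) : 'X_[a] \mPo t = 'X_[mexp m a] \mPo H.
  rewrite comp_mpolyX mpolyX_sum rmorph_prod; apply: eq_bigr => j _.
  by rewrite -mpolyXn rmorphXn tnth_mktuple tnth_monomials.
have := tE b; rewrite tm Ebd -tm dbd // ?tE // => /(mulfI _) E.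
have /(congr1 (mcoeff b)) : 'X_[d] = 'X_[b] :> {mpoly k[n]} by apply/E/expf_neq0.
rewrite !mcoeffX eqxx; case: eqVneq => // _ /eqP; by rewrite eq_sym oner_eq0.
Qed.

End MonomialMaps.

(** * Linear type *)

Section SymInduction.
Import monalg.

Lemma sym_ind (R : comNzRingType) (M : lmodType R) (P : SymAlg.sym M -> Prop) :
    P 0 -> P 1 -> (forall s t, P s -> P t -> P (s + t)) ->
    (forall s t, P s -> P t -> P (s * t)) -> (forall (a : R) s, P s -> P (a *: s)) ->
    (forall x, P (SymAlg.inj x)) ->
  forall s, P s.
Proof.
move=> P0 P1 PD PM PZ PX s; have PXn x i : P (SymAlg.inj x ^+ i).
  by elim: i => [|i IHi]; rewrite ?expr0 // exprS; apply: PM.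
have [p ->] := SymAlg.projP s.
rewrite (monalg.monalgE p) (raddf_sum (@SymAlg.proj R M)).
apply: (big_ind P) => // c _; set a := monalg.mcoeff c p.
rewrite SymAlg.mkmalgUE SymAlg.monomE /= SymAlg.projZ; apply: PZ.
rewrite (rmorph_prod (@SymAlg.proj R M)); apply: (big_ind P) => // x _.
by rewrite (rmorphXn (@SymAlg.proj R M)); exact: PXn.
Qed.

End SymInduction.

(* [{mpoly k[n]}] as the algebra over itself on which the variables act as 0. *)
Section Residue.
Variables (k : fieldType) (n : nat).

Definition residue : Type := {mpoly k[n]}.

HB.instance Definition _ := GRing.ComNzRing.on residue.

Definition residue_scale (a : {mpoly k[n]}) (p : residue) : residue := (a@_0)%:MP * p.

Lemma residue_scaleA a b p :
  residue_scale a (residue_scale b p) = residue_scale (a * b) p.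
Proof. by rewrite /residue_scale (rmorphM (mcoeff 0%MM)) /= mpolyCM mulrA. Qed.
Lemma residue_scale1 : left_id 1 residue_scale.
Proof. by move=> p; rewrite /residue_scale mcoeff1 eqxx mpolyC1 mul1r. Qed.
Lemma residue_scaleDr : right_distributive residue_scale +%R.
Proof. by move=> a p q; rewrite /residue_scale mulrDr. Qed.
Lemma residue_scaleDl p : {morph residue_scale^~ p : a b / a + b}.
Proof. by move=> a b; rewrite /residue_scale mcoeffD mpolyCD mulrDl. Qed.
HB.instance Definition _ := GRing.Zmodule_isLmodule.Build {mpoly k[n]} residue
  residue_scaleA residue_scale1 residue_scaleDr residue_scaleDl.
Lemma residue_scaleAl (a : {mpoly k[n]}) (p q : residue) : a *: (p * q) = a *: p * q.
Proof. exact: mulrA. Qed.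
HB.instance Definition _ :=
  GRing.Lmodule_isLalgebra.Build {mpoly k[n]} residue residue_scaleAl.
HB.instance Definition _ := GRing.Lalgebra_isComAlgebra.Build {mpoly k[n]} residue.

End Residue.

(** * Linear type excludes relations between the monomials *)

Section LinearTypeMonomials.
Variables (k : fieldType) (n : nat) (m : n.-tuple 'X_{1..n}).
Hypothesis deg2 : forall a, a \in m -> mdeg a = 2%N.

Local Notation R := {mpoly k[n]}.
Local Notation gens := (fun f : R => f \in monomials m k).

Lemma gens_mem j : ideal_pred gens 'X_[tnth m j].
Proof. by apply: ideal_sub; apply/monomialsP; exists (tnth m j); rewrite ?mem_tnth. Qed.

Definition gen_mod j : ideal_mod gens := Sub 'X_[tnth m j] (gens_mem j).

Definition sym_mon (b : 'X_{1..n}) : SymAlg.sym (ideal_mod gens) :=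
  \prod_(j < n) SymAlg.inj (gen_mod j) ^+ b j.

Lemma sym_to_rees_mon b :
  val (sym_to_rees (sym_mon b)) = 'X_[mexp m b] *: 'X^(mdeg b).
Proof.
rewrite /sym_mon (rmorph_prod (@sym_to_rees R gens)) (rmorph_prod val).
under eq_bigr do rewrite (rmorphXn (@sym_to_rees R gens)) (rmorphXn val) /= sym_to_rees_inj exprZn.
rewrite mpolyX_sum mdegE expr_sum scaler_prod.
by congr (_ *: _); apply: eq_bigr => j _; rewrite mpolyXn.
Qed.

(** The generators are distinct of equal degree, so none is a proper multiple of another and only
    the constant term of [a] contributes. *)
Lemma mcoeff_gen (a : R) i j : uniq m -> 
  (a * 'X_[tnth m i])@_(tnth m j) = a@_0 * (i == j)%:R.
Proof.
move=> um; rewrite [in LHS](mpolyE a) [in RHS](mpolyE a) mulr_suml !raddf_sum mulr_suml /=.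
apply: eq_bigr => c _; rewrite -scalerAl -mpolyXD !mcoeffZ !mcoeffX -mulrA; congr (_ * _).
rewrite -natrM mulnb; congr (nat_of_bool _)%:R; apply/eqP/andP => [E|[/eqP-> /eqP->]].
  have c0 : c == 0%MM.
    rewrite -mdeg_eq0; move/(congr1 (@mdeg n)): E; by rewrite mdegD !(deg2 (mem_tnth _ m)); lia.
  split=> //; apply/eqP/(tuple_uniqP _ um); by rewrite -E (eqP c0) add0m.
by rewrite add0m.
Qed.

Lemma mcoeff_ideal (a f : R) j : uniq m -> f \in ideal gens ->
  (a * f)@_(tnth m j) = a@_0 * f@_(tnth m j).
Proof.
move=> um; move: f; apply: ideal_min => [|b f g /monomialsP[_ /tnthP[i ->] ->] IHg].
  by rewrite mulr0 !mcoeff0 mulr0.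
rewrite mulrDr !mcoeffD mulrDr IHg mulrA !mcoeff_gen // mulrA.
by rewrite (rmorphM (mcoeff 0%MM)).
Qed.

(** The quotient map from I to I/(x_1, ..., x_n)I, in which the classes of the generators form a
    basis over k; the j-th one is written ['X_j]. *)
Definition residue_coef (f : ideal_mod gens) : residue k n :=
  \sum_(j < n) ((val f : R)@_(tnth m j))%:MP * 'X_j.

Section ResidueLift.
Hypothesis uniq_m : uniq m.

Lemma residue_coef_is_linear : linear residue_coef.
Proof.
move=> a f g; rewrite /residue_coef scaler_sumr -big_split /=; apply: eq_bigr => j _.
have V : val (a *: f + g) = a * val f + val g :> R by exact: (linearP val a f g).
apply: etrans (congr1 (fun h : R => (h@_(tnth m j))%:MP * 'X_j) V) _.
rewrite mcoeffD mcoeff_ideal ?mpolyCD ?mpolyCM ?mulrDl -?mulrA //.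
exact: (valP f).
Qed.

Definition residue_lin : {linear ideal_mod gens -> residue k n} :=
  HB.pack residue_coef (GRing.isLinear.Build _ _ _ _ residue_coef residue_coef_is_linear).

Lemma residue_gen j : residue_lin (gen_mod j) = 'X_j.
Proof.
rewrite /= /residue_coef (bigD1 j) //= mcoeffX eqxx mpolyC1 mul1r big1 ?addr0 // => i ij.
rewrite mcoeffX (inj_eq (elimT (tuple_uniqP _) uniq_m)) eq_sym (negPf ij).
by rewrite mpolyC0 mul0r.
Qed.

Lemma linear_type_inj : linear_type gens -> injective (mexp m).
Proof.
move=> /bij_inj inj_rees b d Ebd; have dbd := mexp_deg (ltn0Sn 1) deg2 Ebd.
have /(congr1 (SymAlg.lift residue_lin)) : sym_mon b = sym_mon d.
  by apply/inj_rees/val_inj; rewrite !sym_to_rees_mon Ebd dbd.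
have liftE c : SymAlg.lift residue_lin (sym_mon c) = 'X_[c] :> {mpoly k[n]}.
  rewrite /sym_mon (rmorph_prod (SymAlg.lift residue_lin)) [RHS]mpolyXE_id.
  apply: eq_bigr => j _; rewrite (rmorphXn (SymAlg.lift residue_lin)) /=.
  by congr (_ ^+ _); exact: etrans (SymAlg.lift_inj _ _) (residue_gen j).
rewrite !liftE => /(congr1 (mcoeff b)); rewrite !mcoeffX eqxx.
by case: eqVneq => // _ /eqP; rewrite oner_eq0.
Qed.

End ResidueLift.

End LinearTypeMonomials.

(** * Exchange between the two sides of a monomial relation *)

Section LinearTypeCriterion.
Variables (n : nat) (m : n.-tuple 'X_{1..n}).
Hypothesis deg2 : forall a, a \in m -> mdeg a = 2%N.
Hypothesis det_m : \det (log_matrix m) != 0.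

Implicit Types a b c d : 'X_{1..n}.

Lemma mexp_inj : injective (mexp m). Proof. exact/mexp_injP. Qed.

(* A nonzero term of the Leibniz expansion. *)
Lemma det_transversal : exists s : {perm 'I_n}, [forall j, tnth m j (s j) != 0%N].
Proof.
apply/existsP; have := det_m; rewrite -det_tr; apply: contraNT.
rewrite negb_exists => /forallP m0; apply/eqP/big1 => s _.
have := m0 s; rewrite negb_forall => /existsP[j]; rewrite negbK => /eqP mj.
by rewrite (bigD1 j) //= !mxE mj mul0r mulr0.
Qed.

Lemma deg2_at a v : mdeg a = 2%N -> a v != 0%N -> exists w, a = (U_(v) + U_(w))%MM.
Proof.
case/deg2P => i [j ->]; rewrite mnmDE !mnm1E addn_eq0 !eqb0 negb_and !negbK.
by case/orP=> /eqP <-; [exists j | exists i; rewrite addmC].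
Qed.

(** At a vertex missed by the support of [b], the factor of [tnth m j] must come from [a]; this
    applies to [v]. The other end [w] of the edge [j] is either supplied by an edge [i] of the
    support, or missed as well, and then any [i] will do. *)
Lemma exchange_uncovered a b c d v j : (a + mexp m b = c + mexp m d)%MM -> b != 0%MM ->
    d j != 0%N -> tnth m j v != 0%N ->
    (forall i, b i != 0%N -> tnth m i v = 0%N) ->
  exists2 i, b i != 0%N & (tnth m j <= a + tnth m i)%MM.
Proof.
move=> E b0 dj mjv bv.
have le_a u : (forall i, b i != 0%N -> tnth m i u = 0%N) -> (tnth m j u <= a u)%N.
  move=> bu; have := congr1 (fun x : 'X_{1..n} => x u) E.
  rewrite /= !mnmDE !mexpE [X in (a u + X)%N]big1 ?addn0 => [->|i _].
    apply: leq_trans (leq_addl _ _); rewrite (bigD1 j) //=.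
    by apply: leq_trans (leq_addr _ _); rewrite leq_pmulr // lt0n.
  by have [->|/bu ->] := eqVneq (b i) 0%N; rewrite ?muln0.
have [w mj] := deg2_at (deg2 (mem_tnth j m)) mjv.
have [/existsP[i /andP[bi miw]]|/existsPn nw] :=
  boolP [exists i, (b i != 0%N) && (tnth m i w != 0%N)].
  exists i => //; apply/mnm_lepP=> u; rewrite mnmDE.
  have [<-|vu] := eqVneq v u; first exact/(leq_trans (le_a _ bv))/leq_addr.
  rewrite mj mnmDE !mnm1E (negPf vu) add0n; have [<-|//] := eqVneq w u.
  by rewrite addnC ltn_addr // lt0n.
have [i bi] : exists i, b i != 0%N.
  apply/existsP; apply: contraNT b0 => /existsPn b0; apply/eqP/mnmP=> i.
  by rewrite mnm0E; apply/eqP; rewrite -[_ == _]negbK.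
exists i => //; apply/mnm_lepP=> u; rewrite mnmDE.
apply: leq_trans (leq_addr _ _).
have [<-|vu] := eqVneq v u; first exact: le_a.
have [<-|wu] := eqVneq w u; last by rewrite mj mnmDE !mnm1E (negPf vu) (negPf wu).
by apply: le_a => i' bi'; apply/eqP; have := nw i'; rewrite bi' negbK.
Qed.

(** The degree of [v] in the subgraph of the edges in the support of [b], a loop counting twice. *)
Let deg_in b v := (\sum_(i | b i != 0%N) tnth m i v)%N.

Let deg_in_eq0 b v : (deg_in b v == 0%N) = [forall i, (b i != 0%N) ==> (tnth m i v == 0%N)].
Proof. by rewrite sum_nat_eq0. Qed.

Lemma sum_deg_in b : (\sum_v deg_in b v = 2 * #|[pred i | b i != 0%N]|)%N.
Proof.
rewrite exchange_big /= -sum1_card big_distrr /=; apply: eq_bigr => i _.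
by rewrite -mdegE deg2 ?mem_tnth.
Qed.

(* If every vertex covered by the support of [b] or [d] is covered by both, then by
   counting (the supports have a transversal) each is covered exactly once by each,
   so both supports have the same sum of columns. *)
Lemma covered_disjoint b d : (forall j, (b j == 0%N) || (d j == 0%N)) ->
  (forall v, (deg_in b v == 0%N) = (deg_in d v == 0%N)) -> b = 0%MM.
Proof.
move=> dis cov; pose Vb := [pred v | deg_in b v != 0%N].
have [s /forallP ms] := det_transversal.
have in_V (x : 'X_{1..n}) j : x j != 0%N -> deg_in x (s j) != 0%N.
  move=> xj; rewrite deg_in_eq0; apply/forallPn; exists j; by rewrite negb_imply xj ms.
(* The transversal [s] sends the edges of both supports injectively to covered vertices. *)
have leV : (#|[pred i | b i != 0%N]| + #|[pred i | d i != 0%N]| <= #|Vb|)%N.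
  rewrite -cardUI [X in (_ + X)%N]eq_card0 ?addn0; last first.
    by move=> j; rewrite !inE -negb_or dis.
  rewrite -(card_imset _ (@perm_inj _ s)); apply/subset_leq_card/subsetP=> v.
  by case/imsetP=> j; rewrite !inE => /orP[bj|dj] ->; [|rewrite cov]; exact: in_V.
have le2 v : ((v \in Vb) * 2 <= deg_in b v + deg_in d v)%N.
  have := cov v; rewrite inE; case: (deg_in b v) (deg_in d v) => [|?] [|?] //; lia.
(* The degrees sum to twice the number of edges, at most [2 * #|Vb|], so equality holds in [le2] at
   every vertex. *)
have eq2 v : (deg_in b v + deg_in d v = (v \in Vb) * 2)%N.
  apply/eqP; rewrite eqn_leq le2 andbT leqNgt; apply/negP => lt2.
  have : (\sum_u (u \in Vb) * 2 < \sum_u (deg_in b u + deg_in d u))%N.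
    rewrite (bigD1 v) //= [ltnRHS](bigD1 v) //= -addSn leq_add // leq_sum //.
  rewrite big_split /= !sum_deg_in -big_distrl /= -mulnDr mulnC ltn_pmul2l //.
  by rewrite -big_mkcond sum1_card ltnNge leV.
have Ebd : mexp m [multinom ((b i != 0%N) : nat) | i < n] =
           mexp m [multinom ((d i != 0%N) : nat) | i < n].
  apply/mnmP=> v; rewrite !mexpE; transitivity (deg_in b v).
    rewrite /deg_in [RHS]big_mkcond; apply: eq_bigr => i _; rewrite mnmE.
    by case: ifP => _; rewrite ?muln1 ?muln0.
  transitivity (deg_in d v).
    have := cov v; have := eq2 v; rewrite inE.
    case: (deg_in b v) (deg_in d v) => [|?] [|?] //=; lia.
  rewrite /deg_in big_mkcond; apply: eq_bigr => i _; rewrite mnmE.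
  by case: ifP => _; rewrite ?muln1 ?muln0.
apply/mnmP=> j; move/mnmP/(_ j): (mexp_inj Ebd); rewrite !mnmE.
by have := dis j; case: (b j) (d j) => [|?] [|?].
Qed.

(** If the supports meet, [i = j] works. Otherwise [covered_disjoint] yields a vertex covered by
    only one of them, and [exchange_uncovered] applies to one side or the other. *)
Lemma exchange a b c d : (a + mexp m b = c + mexp m d)%MM -> mdeg b = mdeg d ->
    b != 0%MM ->
  exists i j, [/\ b i != 0%N, d j != 0%N &
    ((tnth m j <= a + tnth m i)%MM \/ (tnth m i <= c + tnth m j)%MM)].
Proof.
move=> E dbd b0; have d0 : d != 0%MM by rewrite -mdeg_eq0 -dbd mdeg_eq0.
have [/forallP dis|/forallPn[j]] := boolP [forall j, (b j == 0%N) || (d j == 0%N)]; last first.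
  rewrite negb_or => /andP[bj dj]; exists j, j; split=> //; left.
  by apply/mnm_lepP=> u; rewrite mnmDE leq_addl.
have [/forallP cov|/forallPn[v]] :=
  boolP [forall v, (deg_in b v == 0%N) == (deg_in d v == 0%N)].
  by case/eqP: b0; apply: covered_disjoint dis _ => v; exact: (eqP (cov v)).
rewrite !deg_in_eq0.
have [/forallP bv|/forallPn[i]] := boolP [forall i, (b i != 0%N) ==> (tnth m i v == 0%N)];
have [/forallP dv|/forallPn[j]] := boolP [forall i, (d i != 0%N) ==> (tnth m i v == 0%N)] => //.
  rewrite negb_imply => /andP[dj mj] _.
  have [i bi le] : exists2 i, b i != 0%N & (tnth m j <= a + tnth m i)%MM.
    by apply: (exchange_uncovered E b0 dj mj) => i bi; apply/eqP/(implyP (bv i)).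
  by exists i, j; split=> //; left.
rewrite negb_imply => /andP[bi mi] _.
have [j dj le] : exists2 j, d j != 0%N & (tnth m i <= c + tnth m j)%MM.
  by apply: (exchange_uncovered (esym E) d0 bi mi) => j dj; apply/eqP/(implyP (dv j)).
by exists i, j; split=> //; right.
Qed.

End LinearTypeCriterion.

(** Terms with the same key share their vector, so the sum is grouped by key; the induction removes
    one key at a time. *)
Lemma sum_by_key (R : pzRingType) (V : lmodType R) (I K : eqType) (L : seq I)
    (c : I -> R) (key : I -> K) (T : I -> V) :
  (forall x y, key x = key y -> T x = T y) ->
  (forall z, \sum_(x <- L | key x == z) c x = 0) -> \sum_(x <- L) c x *: T x = 0.
Proof.
move=> Tkey; have [s] := ubnP (size L); elim: s L => // s IHs [|y L] ltLs sum0.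
  by rewrite big_nil.
rewrite (bigID (fun x => key x == key y)) /=.
under eq_bigr => x /eqP /Tkey -> do [].
rewrite -scaler_suml sum0 scale0r add0r -big_filter; apply: IHs => [|z].
  rewrite /= eqxx; move: ltLs; rewrite ltnS; apply: leq_ltn_trans.
  rewrite size_filter; exact: count_size.
rewrite big_filter_cond; have [->|zy] := eqVneq z (key y).
  by rewrite big_pred0 // => x; rewrite andNb.
rewrite -[RHS](sum0 z); apply: eq_bigl => x.
by case: eqVneq => [->|]; rewrite ?andbT //= eq_sym (negPf zy).
Qed.

(** * Nonzero determinant implies linear type *)

Section LinearTypeSufficient.
Variables (k : fieldType) (n : nat) (m : n.-tuple 'X_{1..n}).
Hypothesis deg2 : forall a, a \in m -> mdeg a = 2%N.

Local Notation R := {mpoly k[n]}.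
Local Notation gens := (fun f : R => f \in monomials m k).
Local Notation sym := (SymAlg.sym (ideal_mod gens)).
Local Notation gen_mod := (@gen_mod k n m).
Local Notation sym_mon := (@sym_mon k n m).

Lemma sym_monD b c : sym_mon (b + c) = sym_mon b * sym_mon c.
Proof.
by rewrite /sym_mon -big_split; apply: eq_bigr => j _; rewrite mnmDE exprD.
Qed.

Lemma sym_mon0 : sym_mon 0 = 1.
Proof. by rewrite /sym_mon big1 // => j _; rewrite mnm0E expr0. Qed.

Lemma sym_monU j : sym_mon U_(j) = SymAlg.inj (gen_mod j).
Proof.
rewrite /sym_mon (bigD1 j) //= mnm1E eqxx expr1 big1 ?mulr1 // => i ij.
by rewrite mnm1E eq_sym (negPf ij) expr0.
Qed.

Lemma val_idealZ (a : R) (f : ideal_mod gens) : val (a *: f) = a * val f.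
Proof. exact: (linearZ_LR val a f). Qed.

Lemma val_reesZ (a : R) (r : rees_alg gens) : val (a *: r) = a *: val r.
Proof. exact: (linearZ_LR val a r). Qed.

Lemma sym_to_reesZ (a : R) (s : sym) : sym_to_rees (a *: s) = a *: sym_to_rees s.
Proof. exact: SymAlg.lift_is_scalable. Qed.

Lemma sym_to_reesD (s t : sym) : sym_to_rees (s + t) = sym_to_rees s + sym_to_rees t.
Proof. exact: (raddfD (@sym_to_rees R gens)). Qed.

Lemma scale_inj_gen (a : R) j (f : ideal_mod gens) : val f = a * 'X_[tnth m j] ->
  a *: SymAlg.inj (gen_mod j) = SymAlg.inj f.
Proof.
move=> fE; rewrite -SymAlg.inj_is_scalable.
by congr SymAlg.inj; apply: val_inj; rewrite fE; exact: val_idealZ.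
Qed.

(** Both sides are the class of one and the same monomial of I. *)
Lemma sym_swap (a c : 'X_{1..n}) i j : (a + tnth m i = c + tnth m j)%MM ->
  'X_[a] *: sym_mon U_(i) = 'X_[c] *: sym_mon U_(j).
Proof.
move=> E; rewrite !sym_monU (scale_inj_gen (f := 'X_[c] *: gen_mod j)).
  exact: SymAlg.inj_is_scalable.
rewrite -mpolyXD E mpolyXD; exact: val_idealZ.
Qed.

Definition spanned (s : sym) : Prop := exists L : seq (k * 'X_{1..n} * 'X_{1..n}),
  s = \sum_(x <- L) x.1.1%:MP *: ('X_[x.1.2] *: sym_mon x.2).

Lemma spanned_mon e (a b : 'X_{1..n}) : spanned (e%:MP *: ('X_[a] *: sym_mon b)).
Proof. by exists [:: (e, a, b)]; rewrite big_seq1. Qed.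

Lemma spanned0 : spanned 0.
Proof. by exists [::]; rewrite big_nil. Qed.

Lemma spannedD s t : spanned s -> spanned t -> spanned (s + t).
Proof. by move=> [L ->] [L' ->]; exists (L ++ L'); rewrite big_cat. Qed.

Lemma spannedM s t : spanned s -> spanned t -> spanned (s * t).
Proof.
move=> [L ->] [L' ->]; rewrite mulr_suml.
apply: (big_ind spanned spanned0 spannedD) => x _; rewrite mulr_sumr.
apply: (big_ind spanned spanned0 spannedD) => y _.
rewrite -!scalerAl -!scalerAr !scalerA -sym_monD.
rewrite mulrACA -mpolyXD -mpolyCM -scalerA.
exact: spanned_mon.
Qed.

Lemma spannedZ (a : R) s : spanned s -> spanned (a *: s).
Proof.
move=> ss; have -> : a *: s = (a *: sym_mon 0) * s by rewrite sym_mon0 -scalerAl mul1r.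
apply: spannedM ss; rewrite (mpolyE a) scaler_suml.
apply: (big_ind spanned spanned0 spannedD) => c _.
by rewrite -mul_mpolyC -scalerA; exact: spanned_mon.
Qed.

Lemma spanned_inj (f : ideal_mod gens) : spanned (SymAlg.inj f).
Proof.
have /idealP[s [sG fE]] := valP f; elim: s f sG fE => [|x s IHs] f sG fE.
  have -> : f = 0 by apply: val_inj; rewrite fE big_nil; exact/esym/(raddf0 val).
  by rewrite (raddf0 (@SymAlg.inj R (ideal_mod gens))); exact: spanned0.
have /monomialsP[_ /tnthP[j ->] xj] : x.2 \in monomials m k by apply: sG; rewrite inE eqxx.
rewrite big_cons xj in fE.
have -> : SymAlg.inj f = SymAlg.inj (f - x.1 *: gen_mod j) + x.1 *: SymAlg.inj (gen_mod j).
  rewrite (raddfB (@SymAlg.inj R (ideal_mod gens))).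
  by rewrite [X in _ - X]SymAlg.inj_is_scalable subrK.
apply: spannedD; last first.
  rewrite -sym_monU -[sym_mon _]scale1r -mpolyX0; apply: spannedZ.
  by rewrite -[_ *: _]scale1r; exact: spanned_mon.
apply: IHs => [y ys|]; first by apply: sG; rewrite inE ys orbT.
have V : val (f - x.1 *: gen_mod j) = val f - x.1 * 'X_[tnth m j] :> R.
  apply: etrans (raddfB val _ _) _; congr (_ - _); exact: val_idealZ.
by apply: etrans V _; rewrite fE addrC addKr.
Qed.

Lemma spannedP (s : sym) : spanned s.
Proof.
move: s; apply: sym_ind.
- exact: spanned0.
- have := spanned_mon 1 0 0; by rewrite sym_mon0 mpolyX0 mpolyC1 !scale1r.
- exact: spannedD.
- exact: spannedM.
- exact: spannedZ.
exact: spanned_inj.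
Qed.

(** The image is a subalgebra containing all a t with a in I, and [rees] is the least such. *)
Lemma sym_to_rees_surj (r : rees_alg gens) : exists s, sym_to_rees s = r.
Proof.
suff [s sE] : exists s : sym, val (sym_to_rees s) = val r by exists s; apply: val_inj.
have /asboolP reesr := valP r.
pose S : {pred {poly R}} := fun p => `[< exists s : sym, val (sym_to_rees s) = p >].
suff /asboolP : val r \in S by [].
apply: reesr => [|a aI]; last first.
  apply/asboolP; exists (SymAlg.inj (Sub a aI : ideal_mod gens)).
  by rewrite sym_to_rees_inj.
split=> [|a p q /asboolP[s <-] /asboolP[t <-]|p q /asboolP[s <-] /asboolP[t <-]];
  apply/asboolP.
- by exists 1; rewrite rmorph1.
- exists (a *: s + t); rewrite sym_to_reesD sym_to_reesZ; exact: (linearP val).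
by exists (s * t); rewrite (rmorphM (@sym_to_rees R gens)); exact: (rmorphM val).
Qed.

Section Injective.
Hypothesis det_m : \det (log_matrix m) != 0.

(** Induction on the degree in Y: an exchange on one side produces a factor Y_l common to both, and
    the cofactors satisfy a relation of degree one less. *)
Lemma sym_mon_key a b c d : (a + mexp m b = c + mexp m d)%MM -> mdeg b = mdeg d ->
  'X_[a] *: sym_mon b = 'X_[c] *: sym_mon d.
Proof.
move Er : (mdeg b) => r; elim: r a b c d Er => [|r IHr] a b c d Er E /esym Ed.
  move: E; move/eqP: Er; rewrite mdeg_eq0 => /eqP ->.
  by move/eqP: Ed; rewrite mdeg_eq0 => /eqP ->; rewrite !mexp0 !addm0 => ->.
have b0 : b != 0%MM by rewrite -mdeg_eq0 Er.
have split_U (x : 'X_{1..n}) l : x l != 0%N -> mdeg x = r.+1 ->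
    exists2 y, x = (y + U_(l))%MM & mdeg y = r.
  move=> xl xr; have Ux : (U_(l) <= x)%MM by rewrite lep1mP.
  exists (x - U_(l))%MM; first by rewrite submK.
  by move: xr; rewrite -{1}(submK Ux) mdegD mdeg1 addn1 => -[].
have [i [j [bi dj le_ij]]] := exchange deg2 det_m E (etrans Er (esym Ed)) b0.
have [b' Eb rb] := split_U _ _ bi Er; have [d' Edd rd] := split_U _ _ dj Ed.
rewrite Eb Edd !mexpD !mexpU in E *.
have swap (x y z : 'X_{1..n}) i' j' : (x + tnth m i' = y + tnth m j')%MM ->
    'X_[x] *: sym_mon (z + U_(i')) = 'X_[y] *: sym_mon (z + U_(j')).
  by move=> xy; rewrite !sym_monD !scalerAr (sym_swap xy).
have cancel (x y z w : 'X_{1..n}) l : (x + mexp m z = y + mexp m w)%MM ->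
    mdeg z = r -> mdeg w = r ->
    'X_[x] *: sym_mon (z + U_(l)) = 'X_[y] *: sym_mon (w + U_(l)).
  by move=> xy zr wr; rewrite !sym_monD !scalerAl (IHr _ _ _ _ zr xy (esym wr)).
case: le_ij => le.
  rewrite (swap a (a + tnth m i - tnth m j)%MM b' i j) ?submK //; apply: cancel => //.
  apply/mnmP=> u; move/mnm_lepP/(_ u): le; have /mnmP/(_ u) := E.
  rewrite !mnmDE !mnmBE !mnmDE; lia.
rewrite (swap c (c + tnth m j - tnth m i)%MM d' j i) ?submK //; apply: cancel => //.
apply/mnmP=> u; move/mnm_lepP/(_ u): le; have /mnmP/(_ u) := E.
rewrite !mnmDE !mnmBE !mnmDE; lia.
Qed.

(** The key of a term records its exponents in x and t after mapping to the Rees algebra. Equal keys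
    mean equal terms by [sym_mon_key], and the coefficients with a given key sum to a coefficient of
    the image, which is 0. *)
Lemma sym_to_rees_ker (s : sym) : sym_to_rees s = 0 -> s = 0.
Proof.
have [L ->] := spannedP s => /(congr1 val) s0.
pose key (x : k * 'X_{1..n} * 'X_{1..n}) := ((x.1.2 + mexp m x.2)%MM, mdeg x.2).
apply: (sum_by_key (key := key)) => [x y|[p r]].
  by move=> Exy; exact: sym_mon_key (congr1 fst Exy) (congr1 snd Exy).
rewrite -(raddf_sum (@mpolyC n k)) /=; apply/eqP; rewrite mpolyC_eq0; apply/eqP.
have /(congr1 (fun q : {poly R} => (q`_r)@_p)) :
    \sum_(x <- L) (x.1.1 *: 'X_[(key x).1]) *: 'X^((key x).2) = 0 :> {poly R}.
  apply: etrans s0; rewrite (raddf_sum (@sym_to_rees R gens)) (raddf_sum val).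
  apply: eq_bigr => x _ /=.
  rewrite !sym_to_reesZ !val_reesZ sym_to_rees_mon !scalerA.
  by rewrite -mulrA -mpolyXD mul_mpolyC.
rewrite coef_sum coef0 mcoeff0 raddf_sum => s1; rewrite -[RHS]s1 big_mkcond.
apply: eq_bigr => x _ /=.
rewrite coefZ coefXn xpair_eqE [r == _]eq_sym.
case: (mdeg x.2 == r); last by rewrite andbF mulr0 mcoeff0.
by rewrite andbT mulr1 mcoeffZ mcoeffX; case: eqP; rewrite ?mulr1 ?mulr0.
Qed.

Lemma linear_type_monomials : linear_type gens.
Proof.
have [g gE] := choice sym_to_rees_surj.
exists g => // s; apply/eqP; rewrite -subr_eq0; apply/eqP/sym_to_rees_ker.
by rewrite (raddfB (@sym_to_rees R gens)) /= gE subrr.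
Qed.

End Injective.
End LinearTypeSufficient.

(** * Equivalence of the four conditions *)

Unset Implicit Arguments.

Theorem proposition5p1 (k : fieldType) (n : nat) (m : n.-tuple 'X_{1..n})
    (F := monomials m k) (Gt := graph m) (G := simple_part Gt)
    (hdistinct : uniq m)
    (hdeg2 : forall a, a \in m -> mdeg a = 2%N)
    (hcohesive : cohesive F)
    (hfactor : no_common_factor F)
    (hvars : forall i : 'I_n, exists2 f, f \in F & mpdvd 'X_i f) :
  [<-> (* i *) \det (log_matrix m) != 0;
       (* ii *) cremona F;
       (* iii *)
         [/\ Gt =2 G & exists2 c, unique_cycle G c & odd (size c)]
         \/ is_tree G /\ #|[set i | Gt i i]| = 1%N;
       (* iv *) linear_type (fun f => f \in F)].
Proof.
have n_gt0 := no_common_factor_gt0 hfactor.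
have conn : forall x y, connect Gt x y.
  by case: hcohesive => _ _ nsep; exact: not_separated_connect nsep hvars.
have detP := mexp_injP m.
(* The implications run in a cycle; those from (ii) to (iii) and from (iii) to (iv) pass through
   (i). *)
tfae.
- move=> dA; apply: span_cremona => //; first exact/detP.
  exact: span_pairs (det_double_cover hdeg2 conn (Ordinal n_gt0) dA).
- by move/(cremona_inj hdeg2)/detP; exact: det_graph.
- by move/(graph_det conn); exact: linear_type_monomials.
by move/(linear_type_inj hdeg2 hdistinct)/detP.
Qed.
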